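(* Let $f:\mathbb{C}\to\widehat{\mathbb{C}}$ be a transcendental meromorphic function which has a Baker wandering domain. Then for every point $z$ in the backward orbit of $\infty$, that is, in the set $$\{z\in\widehat{\mathbb{C}} : f^m(z)=\infty \text{ for some } m\geq 1\},$$ the singleton $\{z\}$ is a Julia component of $f$, and this Julia component is buried.
   Context: $\widehat{\mathbb{C}}=\mathbb{C}\cup\{\infty\}$. A transcendental meromorphic function $f:\mathbb{C}\to\widehat{\mathbb{C}}$ is meromorphic on $\mathbb{C}$ with its single essential singularity at $\infty$; it may have finitely many, infinitely many, or no poles. $f^n$ denotes the $n$-fold iterate. The Fatou set of $f$ is the set of points of $\widehat{\mathbb{C}}$ having a neighborhood on which all iterates $f^n$ are defined and form a normal family; the Julia set $\mathcal{J}(f)$ is its complement in $\widehat{\mathbb{C}}$ (so $\infty$ and every point at which some iterate is undefined belong to $\mathcal{J}(f)$). A Fatou component is a connected component of the Fatou set; a Julia component is a maximally connected subset (connected component) of $\mathcal{J}(f)$. A Julia component is buried if it does not intersect the boundary of any Fatou component. For a Fatou component $W$, $W_n$ denotes the Fatou component containing $f^n(W)$ ($W_0=W$). $W$ is wandering if $W_m\cap W_n=\emptyset$ for all $m\neq n$. A domain $U$ is multiply connected if $\widehat{\mathbb{C}}\setminus U$ has more than one component. A set $A$ surrounds a set (or point) $B$ if $B$ is contained in a bounded component of $\widehat{\mathbb{C}}\setminus A$. A Baker wandering domain of $f$ is a wandering domain $W$ of $f$ such that for all sufficiently large $n$, $W_n$ is multiply connected, bounded and surrounds $0$, with $\mathrm{dist}(W_n,0)\to\infty$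 and $f^n(z)\to\infty$ as $n\to\infty$ for all $z\in W$. *)

(* Defs.v *)
From HB Require Import structures.
From mathcomp Require Import all_boot all_order all_algebra.
From mathcomp Require Import complex.
From mathcomp Require Import all_classical all_reals all_analysis.

Set Implicit Arguments.
Unset Strict Implicit.
Unset Printing Implicit Defensive.

Import Order.TTheory GRing.Theory Num.Theory.
Import numFieldNormedType.Exports.

Local Open Scope classical_set_scope.
Local Open Scope ring_scope.

(* The topology of a numeric field is attached to bundled field types only, so
   the bare type [R[i]] has none.  Since the field of scalars is [Cplx R]
   itself, [derivable g z 1] for [g : Cplx R -> Cplx R] is complex
   differentiability. *)
Definition Cplx (R : realType) : numClosedFieldType := R[i].

(* Carrier [option (Cplx R)], [None] being the point at infinity. *)
Notation sphere R := (one_point_compactification (Cplx R)).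

Section Sphere.
Variable R : realType.
Implicit Types (x y : sphere R) (A B U K : set (sphere R)).

Definition infty : sphere R := None.

Definition of_cplx (z : Cplx R) : sphere R := Some z.

(* Junk value 0 at infinity. *)
Definition to_cplx x : Cplx R := odflt 0 x.

Definition cmod (z : Cplx R) : R := ComplexField.Normc.normc z.

Definition chordal x y : R :=
  match x, y with
  | Some z, Some w =>
      2 * cmod (z - w)
        / (Num.sqrt (1 + cmod z ^+ 2) * Num.sqrt (1 + cmod w ^+ 2))
  | Some z, None | None, Some z => 2 / Num.sqrt (1 + cmod z ^+ 2)
  | None, None => 0
  end.

Definition component A K := exists2 x, A x & K = connected_component A x.

Definition boundary A : set (sphere R) := closure A `\` interior A.

Definition bounded_in_cplx A := ~ A infty /\ bounded_set (of_cplx @^-1` A).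

Definition multiply_connected U :=
  exists K1 K2, [/\ component (~` U) K1, component (~` U) K2 & K1 <> K2].

Definition surrounds A B :=
  exists K, [/\ component (~` A) K, bounded_in_cplx K & B `<=` K].

(* Euclidean distance to 0 of the finite part of [A]. *)
Definition dist0 A : R := inf [set cmod z | z in of_cplx @^-1` A].

Definition locally_uniform_cvg U (g : nat -> sphere R -> sphere R)
    (h : sphere R -> sphere R) :=
  forall x, U x -> exists2 V, nbhs x V &
    forall e : R, 0 < e ->
      \forall k \near \oo, forall y, V y -> U y -> chordal (g k y) (h y) < e.

Definition normal_family U (F : set (sphere R -> sphere R)) :=
  forall g : nat -> sphere R -> sphere R, (forall k, F (g k)) ->
  exists (phi : nat -> nat) (h : sphere R -> sphere R),
    {homo phi : m n / (m < n)%N} /\ locally_uniform_cvg U (g \o phi) h.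

End Sphere.

Arguments infty {R}.

Section Dynamics.
Variable R : realType.
Variable f : Cplx R -> sphere R.
Implicit Types (x y : sphere R) (A K V W : set (sphere R)).

(* Poles are the points with value [infty]; they are isolated, and f tends to
   infinity there. *)
Definition meromorphic := forall z : Cplx R,
  (f z <> infty ->
     (\forall w \near z, f w <> infty) /\
     derivable (fun w => to_cplx (f w)) z 1) /\
  (f z = infty ->
     (\forall w \near z^', f w <> infty) /\ f w @[w --> z^'] --> infty).

(* If poles accumulate at infinity, the singularity there is not isolated;
   "essential" then still means that f has no limit in the sphere, i.e. that no
   choice of the value at infinity extends f continuously. *)
Definition essential_at_infty :=
  forall l : sphere R,
    ~ {for infty, continuous (oapp f l : sphere R -> sphere R)}.

Definition transcendental_meromorphic := meromorphic /\ essential_at_infty.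

(* [iterate n x = Some y] when f^n is defined at x with value y (possibly
   y = infty); [iterate n x = None] when f^n is undefined at x. *)
Fixpoint iterate (n : nat) x : option (sphere R) :=
  if n is m.+1 then
    match iterate m x with
    | Some (Some z) => Some (f z)
    | _ => None
    end
  else Some x.

(* Total version, with junk value [infty] where f^n is undefined; it is used
   only where all iterates are defined. *)
Definition iterate_total n x : sphere R := odflt infty (iterate n x).

Definition Fatou : set (sphere R) :=
  [set x | exists U : set (sphere R), [/\ open_nbhs x U,
     forall n y, U y -> iterate n y <> None &
     normal_family U (range iterate_total)]].

Definition Julia : set (sphere R) := ~` Fatou.

Definition Fatou_component W := component Fatou W.

Definition Julia_component K := component Julia K.

Definition buried K :=
  forall W, Fatou_component W -> K `&` boundary W = set0.

(* [Wn n] is the Fatou component containing f^n(W). *)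
Definition component_orbit W (Wn : nat -> set (sphere R)) :=
  Wn 0%N = W /\
  forall n, Fatou_component (Wn n) /\
    forall x y, W x -> iterate n x = Some y -> Wn n y.

Definition Baker_wandering_domain W :=
  exists Wn : nat -> set (sphere R),
  [/\ Fatou_component W,
      component_orbit W Wn,
      forall m n, m <> n -> Wn m `&` Wn n = set0,
      \forall n \near \oo, [/\ multiply_connected (Wn n),
        bounded_in_cplx (Wn n) & surrounds (Wn n) [set of_cplx 0]] &
      (dist0 (Wn n) @[n --> \oo] --> +oo) /\
      (forall x, W x -> iterate_total n x @[n --> \oo] --> infty)].

End Dynamics.

(* Main.v *)
Require Import Defs.
From mathcomp Require Import all_boot all_order all_algebra.
From mathcomp Require Import complex.
From mathcomp Require Import all_classical all_reals all_analysis.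
Import Order.TTheory GRing.Theory Num.Theory.
Import numFieldNormedType.Exports.
Local Open Scope classical_set_scope.
Local Open Scope ring_scope.
From mathcomp Require Import ring lra.

(** Write [W_n] for the Fatou component containing [f ^ n (W)], where [W] is
    the Baker wandering domain.  For large [n] the complement of [W_n] has a
    component that contains a disc of large radius around 0 but not infinity.
    In a compact Hausdorff space components are quasi-components, so this
    complement splits into two disjoint closed sets [B] and [C], with the disc
    in [B] and infinity in [C] (Baker_separation).  The Julia set is contained
    in the complement, so it is cut along arbitrarily small neighbourhoods of
    infinity.

    Let [f ^ m (z)] be infinite, and take a small circle around [z] on which
    [f ^ m] has no infinite value, hence values in a disc contained in [B].
    Inside the circle the preimage of [C] under [f ^ m] is relatively closed,
    and it is relatively open in any set that [f ^ m] maps into the union of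
    [B] and [C].  So a connected set of this kind that accumulates at [z] is
    trapped inside the circle (connected_near_pole).  The Julia component of
    [z] is such a set, because defined iterates stay in the Julia set: it is
    therefore [{z}].  If [z] were in the closure of a Fatou component [V], then
    [f ^ m (V)] would meet [W_n] for infinitely many [n], otherwise [V] would be
    trapped too; but [f ^ m (V)] is a connected subset of the Fatou set, and
    the [W_n] are distinct components.

    Two facts of complex analysis enter: points with a given value are
    isolated, which provides the circles, and [f] is open, which gives the
    forward invariance of the Fatou set (Fatou_image).  Both follow from the
    maximum modulus principle for functions that are merely complex
    differentiable.  Goursat's bisection argument is applied to
    [g (a + r e^(s + it))] on rectangles in the [(s, t)] plane, contour
    integrals being expressed by primitives of real functions; since this
    function is periodic in [t], the mean value inequality at the centre [a]
    follows (Re_center_le).  For isolation, dividing by [k] zeros close to the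
    centre improves the maximum bound by a factor [2 ^ - k] (many_zeros). *)

Set Implicit Arguments.
Unset Strict Implicit.
Unset Printing Implicit Defensive.

(** * The complex plane *)

Section ComplexPlane.
Variable R : realType.
Implicit Types (x y z w : Cplx R) (e r : R).

Lemma cmodE z : `|z| = ((cmod z)%:C%C : Cplx R).
Proof. by rewrite (normc_def (z : R[i])); case: z. Qed.

Lemma cmod_ge0 z : 0 <= cmod z.
Proof. by rewrite -ler0c -cmodE normr_ge0. Qed.

Lemma cmod0 : cmod (0 : Cplx R) = 0.
Proof. by apply: complexI; rewrite -cmodE normr0. Qed.

Lemma cmod1 : cmod (1 : Cplx R) = 1.
Proof. by apply: complexI; rewrite -cmodE normr1. Qed.

Lemma cmod_eq0 z : (cmod z == 0) = (z == 0).
Proof.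
apply/eqP/eqP => [h|->]; last exact: cmod0.
by apply/eqP; rewrite -normr_eq0 cmodE h.
Qed.

Lemma cmod_gt0 z : (0 < cmod z) = (z != 0).
Proof. by rewrite lt_def cmod_ge0 andbT cmod_eq0. Qed.

Lemma cmodM x y : cmod (x * y) = cmod x * cmod y.
Proof. by apply: complexI; rewrite rmorphM /= -!cmodE normrM. Qed.

Lemma cmodX x n : cmod (x ^+ n) = cmod x ^+ n.
Proof. by elim: n => [|n IH]; rewrite ?expr0 ?cmod1// !exprS cmodM IH. Qed.

Lemma cmodV x : cmod x^-1 = (cmod x)^-1.
Proof. by apply: complexI; rewrite fmorphV /= -!cmodE normfV. Qed.

Lemma cmodN x : cmod (- x) = cmod x.
Proof. by apply: complexI; rewrite -!cmodE normrN. Qed.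

Lemma cmodB x y : cmod (x - y) = cmod (y - x).
Proof. by rewrite -cmodN opprB. Qed.

Lemma cmodD x y : cmod (x + y) <= cmod x + cmod y.
Proof. by rewrite -lecR rmorphD /= -!cmodE ler_normD. Qed.

Lemma cmod_dist x y z : cmod (x - z) <= cmod (x - y) + cmod (y - z).
Proof. by have := cmodD (x - y) (y - z); rewrite addrA subrK. Qed.

Lemma cmodR (a : R) : cmod (a%:C%C : Cplx R) = `|a|.
Proof. by apply: complexI; rewrite -cmodE (normc_def (a%:C)%C) /= expr0n addr0 sqrtr_sqr. Qed.

Lemma Re_cmod z : `|complex.Re z| <= cmod z.
Proof. by rewrite -lecR -cmodE normc_ge_Re. Qed.

Lemma cmod_prod (I : Type) (s : seq I) (F : I -> Cplx R) :
  cmod (\prod_(i <- s) F i) = \prod_(i <- s) cmod (F i).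
Proof. exact: (big_morph _ cmodM cmod1). Qed.

(** Neighbourhoods in the plane, with real radii. *)
Lemma nbhs_cplxP z (U : set (Cplx R)) :
  nbhs z U <-> exists2 e, 0 < e & forall w, cmod (w - z) < e -> U w.
Proof.
split=> [/nbhs_ballP[e /= e0 eU]|[e e0 eU]].
- move: e0; rewrite ltcE /= => /andP[/eqP e1 e0].
  exists (complex.Re e) => // w zw; apply: eU.
  by rewrite -ball_normE /= distrC cmodE ltcE /= e1 eqxx.
- apply/nbhs_ballP; exists (e%:C)%C => /=; first by rewrite ltcR.
  by move=> w; rewrite -ball_normE /= distrC cmodE ltcR; exact: eU.
Qed.

Lemma near_cplx z e : 0 < e -> \forall w \near z, cmod (w - z) < e.
Proof. by move=> e0; apply/nbhs_cplxP; exists e. Qed.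

Lemma cvg_cplxP (T : Type) (F : set_system T) (FF : Filter F)
    (f : T -> Cplx R) (l : Cplx R) :
  f @ F --> l <-> forall e, 0 < e -> \forall t \near F, cmod (f t - l) < e.
Proof.
split=> [fl e e0|h U /nbhs_cplxP[e e0 eU]].
  by have /= := fl _ (near_cplx l e0).
by apply: filterS (h e e0) => t; exact: eU.
Qed.

Lemma dist_continuous z : continuous (fun w => cmod (w - z)).
Proof.
move=> y; apply/(@cvgrPdist_lt R R^o _ _ (nbhs_filter y)) => e e0.
apply: filterS (near_cplx y e0) => w h.
rewrite ltr_norml ltrBlDr ltrBrDr.
have := cmod_dist w y z; have := cmod_dist y w z; rewrite (cmodB y w).
by move=> h1 h2; apply/andP; split; lra.
Qed.

Lemma cplx_hausdorff : hausdorff_space (Cplx R).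
Proof. exact: norm_hausdorff. Qed.

(** The complex number with given real and imaginary parts. *)
Definition cmk (p : R * R) : Cplx R := (p.1 +i* p.2)%C.

Lemma cmod_le_ReIm z : cmod z <= `|complex.Re z| + `|complex.Im z|.
Proof.
rewrite {1}(complexE z); apply: (le_trans (cmodD _ _)).
rewrite cmodR cmodM cmodR lerD2l -[leRHS]mul1r ler_wpM2r//.
by rewrite -lecR -cmodE normc_def /= expr0n expr1n add0r sqrtr1.
Qed.

Lemma Im_cmod z : `|complex.Im z| <= cmod z.
Proof.
have := Re_cmod (z * 'i)%C; rewrite ReiNIm normrN cmodM.
have -> : cmod ('i%C : Cplx R) = 1; last by rewrite mulr1.
by apply: complexI; rewrite -cmodE normc_def /= expr0n expr1n add0r sqrtr1.
Qed.

Lemma cmk_continuous : continuous cmk.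
Proof.
move=> p; apply/cvg_cplxP => e e0.
have e20 : 0 < e / 2 by lra.
have h : \forall q \near p, `|p.1 - q.1| < e / 2 /\ `|p.2 - q.2| < e / 2.
  exists (ball p.1 (e / 2), ball p.2 (e / 2)) => /=; first by split; exact: nbhsx_ballx.
  by move=> q.
apply: filterS h => q [h1 h2]; apply: (le_lt_trans (cmod_le_ReIm _)) => /=.
rewrite (distrC q.1) (distrC q.2); lra.
Qed.

(** The closed disc of centre [z] and radius [r]. *)
Definition disc z r : set (Cplx R) := [set w | cmod (w - z) <= r].

Lemma disc_closed z r : closed (disc z r).
Proof.
apply: (@closed_comp _ R^o (fun w => cmod (w - z)) [set x | x <= r]).
  by move=> w _; exact: dist_continuous.
exact: closed_le.
Qed.

Lemma disc_compact z r : compact (disc z r).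
Proof.
pose S := `[complex.Re z - r, complex.Re z + r]%classic `*` `[complex.Im z - r, complex.Im z + r]%classic.
have cS : compact S by apply: compact_setX; exact: segment_compact.
apply: (@subclosed_compact _ _ (cmk @` S)).
- exact: disc_closed.
- by apply: continuous_compact cS; apply: continuous_subspaceT; exact: cmk_continuous.
move=> w wz; exists (complex.Re w, complex.Im w); last by case: w wz.
have h1 := le_trans (Re_cmod _) wz; have h2 := le_trans (Im_cmod _) wz.
move: h1 h2; rewrite /S; clear; case: w z => a b [c d] /=; rewrite !ler_norml => /andP[h1 h2] /andP[h3 h4].
by split; rewrite /= in_itv /=; apply/andP; split; lra.
Qed.

Lemma cplx_locally_compact : locally_compact [set: Cplx R].
Proof.
move=> z _; rewrite withinET; exists (disc z 1).
  by apply/nbhs_cplxP; exists 1 => // w; exact: ltW.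
by split; [exact: disc_compact|exact: disc_closed].
Qed.

End ComplexPlane.

(** * Differentiability by linear approximation *)

Lemma derivable_approx (K : numFieldType) (f : K -> K) (x : K) :
  derivable f x 1 -> forall e : K, 0 < e ->
  \forall y \near x, `|f y - f x - (y - x) * 'D_1 f x| <= e * `|y - x|.
Proof.
move=> df e e0.
have /cvgrPdist_le /(_ e e0) := df.
rewrite /dnbhs near_withinE => /nbhs_ballP[d /= d0 h].
apply/nbhs_ballP; exists d => //= y.
rewrite -ball_normE /= => yx.
have [->|nyx] := eqVneq y x; first by rewrite !subrr mul0r subr0 !normr0 mulr0.
have yx0 : y - x != 0 by rewrite subr_eq0.
have := h (y - x); rewrite /= -ball_normE /= sub0r opprB => /(_ yx yx0).
rewrite /GRing.scale /= mulr1 subrK => h1.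
have -> : f y - f x - (y - x) * 'D_1 f x = - ((y - x) * ('D_1 f x - (y - x)^-1 * (f y - f x))).
  by field.
rewrite normrN normrM mulrC ler_wpM2r//.
Qed.

Lemma is_derive_approx (R : realType) (f : R -> R) (x d : R) :
  is_derive x 1 f d -> forall e, 0 < e -> exists2 dl, 0 < dl &
  forall y, `|y - x| < dl -> `|f y - f x - d * (y - x)| <= e * `|y - x|.
Proof.
move=> fd e e0.
have /derivable_approx/(_ _ e0) : derivable f x 1 by [].
rewrite derive_val => /nbhs_ballP[dl /= dl0 h]; exists dl => // y yx.
rewrite (mulrC d); apply: h; rewrite -ball_normE /= distrC //.
Qed.

Section ComplexDerivative.
Variable R : realType.
Implicit Types (x y z w : Cplx R) (e r : R) (g h : Cplx R -> Cplx R).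

(** Complex differentiability at a point, as a linear approximation with real
    error bounds; cdiffP identifies it with [derivable g z 1]. *)
Definition cdiff g z := exists c : Cplx R, forall e, 0 < e -> exists2 d, 0 < d &
  forall w, cmod (w - z) < d -> cmod (g w - g z - c * (w - z)) <= e * cmod (w - z).

Lemma derivable_cdiff g z : derivable g z 1 -> cdiff g z.
Proof.
move=> dg; exists ('D_1 g z) => e e0.
have e0' : 0 < (e%:C%C : Cplx R) by rewrite ltcR.
have /nbhs_cplxP[d d0 h] := derivable_approx dg e0'.
by exists d => // w /h; rewrite mulrC !cmodE -rmorphM lecR.
Qed.

Lemma cdiff_derivable g z : cdiff g z -> derivable g z 1.
Proof.
move=> [c hc]; apply/cvg_ex; exists c; apply/cvg_cplxP => e e0.
have [d d0 h] : exists2 d, 0 < d & forall w, cmod (w - z) < d -> cmod (g w - g z - c * (w - z)) <= e / 2 * cmod (w - z).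
  by apply: hc; lra.
rewrite /dnbhs near_withinE; apply/nbhs_cplxP; exists d => // w.
rewrite subr0 => wd w0; have := h (w + z).
rewrite addrK /GRing.scale /= mulr1 => /(_ wd) hw.
have -> : w^-1 * (g (w + z) - g z) - c = w^-1 * (g (w + z) - g z - c * w) by field.
rewrite cmodM cmodV ltr_pdivrMl ?cmod_gt0//.
apply: (le_lt_trans hw); rewrite mulrC ltr_pM2l ?cmod_gt0//; lra.
Qed.

Lemma cdiffP g z : cdiff g z <-> derivable g z 1.
Proof. by split; [exact: cdiff_derivable|exact: derivable_cdiff]. Qed.

Lemma cdiff_continuous g z : cdiff g z -> {for z, continuous g}.
Proof. by move/cdiffP/derivable1_diffP/differentiable_continuous. Qed.

Lemma cdiffM g h z : cdiff g z -> cdiff h z -> cdiff (fun w => g w * h w) z.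
Proof. by move=> /cdiffP dg /cdiffP dh; apply/cdiffP; exact: (derivableM dg dh). Qed.

Lemma cdiffD g h z : cdiff g z -> cdiff h z -> cdiff (fun w => g w + h w) z.
Proof. by move=> /cdiffP dg /cdiffP dh; apply/cdiffP; exact: (derivableD dg dh). Qed.

Lemma cdiff_cst c z : cdiff (fun=> c) z.
Proof. by apply/cdiffP; exact: derivable_cst. Qed.

Lemma cdiff_id z : cdiff (fun w => w) z.
Proof. by apply/cdiffP; exact: derivable_id. Qed.

Lemma cdiffV g z : g z != 0 -> cdiff g z -> cdiff (fun w => (g w)^-1) z.
Proof. by move=> gz /cdiffP dg; apply/cdiffP; exact: (derivableV gz dg). Qed.

Lemma cdiffX g n z : cdiff g z -> cdiff (fun w => g w ^+ n) z.
Proof.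
move=> dg; elim: n => [|n IH]; first exact: cdiff_cst.
have -> : (fun w => g w ^+ n.+1) = (fun w => g w * g w ^+ n) by apply/funext => w; rewrite exprS.
exact: cdiffM.
Qed.

Lemma cdiff_prod (I : Type) (s : seq I) (F : I -> Cplx R -> Cplx R) z :
  (forall i, cdiff (F i) z) -> cdiff (fun w => \prod_(i <- s) F i w) z.
Proof.
move=> dF; elim: s => [|i s IH].
  have -> : (fun w => \prod_(i <- [::]) F i w) = fun=> 1 by apply/funext => w; rewrite big_nil.
  exact: cdiff_cst.
have -> : (fun w => \prod_(j <- i :: s) F j w) = (fun w => F i w * \prod_(j <- s) F j w).
  by apply/funext => w; rewrite big_cons.
exact: cdiffM.
Qed.

End ComplexDerivative.

(** * Goursat's theorem in real form *)

Section RealPrimitives.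
Variable R : realType.
Implicit Types (u v : R -> R).

(** The integral of [u] from [- M] to [x], which for continuous [u] is a
    primitive of [u] on the open interval from [- M] to [M] (prim_derive).
    Differences of its values play the part of integrals below. *)
Definition prim (M : R) u (x : R) : R :=
  (\int[lebesgue_measure]_(t in `[- M, x]) u t)%R.

Lemma prim_derive (M : R) u (x : R) : continuous u -> - M < x < M ->
  is_derive x 1 (prim M u) (u x).
Proof.
move=> cu /andP[x1 x2].
have iu : (@lebesgue_measure R).-integrable `[- M, M] (EFin \o u).
  apply: continuous_compact_integrable; first exact: segment_compact.
  exact: continuous_subspaceT.
have [d1 d2] := @continuous_FTC1_closed R u (- M) x M x2 iu x1 (cu x).
by rewrite derive1E in d2; rewrite /prim; exact: (DeriveDef d1 d2).
Qed.

Lemma prim_MVT (M : R) u v (a b : R) : continuous u -> continuous v ->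
  - M < a -> a < b -> b < M -> exists2 x, a < x < b &
  (prim M u b - prim M v b) - (prim M u a - prim M v a) = (u x - v x) * (b - a).
Proof.
move=> cu cv aM ab bM.
have dd x : - M < x < M -> is_derive x 1 (fun x => prim M u x - prim M v x) (u x - v x).
  by move=> xM; apply: is_deriveB; exact: prim_derive.
have [||x xab h] := @MVT R (fun x => prim M u x - prim M v x) (fun x => u x - v x) a b ab.
- by move=> x; rewrite in_itv /= => /andP[h1 h2]; apply: dd; apply/andP; split; lra.
- apply: continuous_in_subspaceT => x; rewrite inE /= in_itv /= => /andP[h1 h2].
  have hx : - M < x < M by apply/andP; split; lra.
  have := dd x hx => -[d _]; exact: (differentiable_continuous (iffLR (derivable1_diffP _ _) d)).
by exists x => //; move: xab; rewrite in_itv.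
Qed.

End RealPrimitives.

Section Goursat.
Variable R : realType.
Variables (M : R) (u v : R -> R -> R) (a0 b0 c0 d0 : R).
Hypothesis cu : forall s, continuous (u s).
Hypothesis cv : forall t, continuous (v^~ t).
Hypotheses (aM : - M < a0) (bM : b0 < M) (cM : - M < c0) (dM : d0 < M).

(** The integral of [v dx + u dy] along the boundary of the rectangle with
    sides [a <= x <= b] and [c <= y <= d].  For [g = u + i v] it is the
    imaginary part of the contour integral of [g]. *)
Definition circulation a b c d :=
  (prim M (u b) d - prim M (u b) c) - (prim M (u a) d - prim M (u a) c)
  + (prim M (v^~ c) b - prim M (v^~ c) a) - (prim M (v^~ d) b - prim M (v^~ d) a).

(** At [(s0, t0)], relatively to the rectangle [a0 <= s <= b0],
    [c0 <= t <= d0], the pair [(u, v)] has a linear approximation whose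
    coefficients satisfy the Cauchy-Riemann equations: [k + i l] is the complex
    derivative of [u + i v]. *)
Definition cauchy_riemann s0 t0 := exists k l : R, forall e, 0 < e ->
  exists2 dl, 0 < dl & forall s t,
    a0 <= s <= b0 -> c0 <= t <= d0 -> `|s - s0| < dl -> `|t - t0| < dl ->
    `|u s t - u s0 t0 - k * (s - s0) + l * (t - t0)| <= e * (`|s - s0| + `|t - t0|) /\
    `|v s t - v s0 t0 - l * (s - s0) - k * (t - t0)| <= e * (`|s - s0| + `|t - t0|).

(** The linear part has zero circulation, so only the error term contributes;
    it is quadratic in the size of the rectangle. *)
Lemma circulation_local k l e a b c d s0 t0 : 0 <= e ->
  a0 <= a -> a < b -> b <= b0 -> c0 <= c -> c < d -> d <= d0 ->
  a <= s0 <= b -> c <= t0 <= d ->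
  (forall s t, a <= s <= b -> c <= t <= d ->
    `|u s t - u s0 t0 - k * (s - s0) + l * (t - t0)| <= e * (`|s - s0| + `|t - t0|) /\
    `|v s t - v s0 t0 - l * (s - s0) - k * (t - t0)| <= e * (`|s - s0| + `|t - t0|)) ->
  `|circulation a b c d| <= 2 * e * ((b - a) + (d - c)) ^+ 2.
Proof.
move=> e0 ha ab hb hc cd hd /andP[sa sb] /andP[tc td] H.
have cM' : - M < c by exact: lt_le_trans hc.
have dM' : d < M by exact: le_lt_trans dM.
have aM' : - M < a by exact: lt_le_trans ha.
have bM' : b < M by exact: le_lt_trans bM.
have [x /andP[x1 x2] hx] := prim_MVT (@cu b) (@cu a) cM' cd dM'.
have [y /andP[y1 y2] hy] := prim_MVT (@cv c) (@cv d) aM' ab bM'.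
set L := (b - a) + (d - c).
have L0 : 0 <= L by rewrite /L; lra.
have near_le s t : a <= s <= b -> c <= t <= d -> e * (`|s - s0| + `|t - t0|) <= e * L.
  move=> /andP[h1 h2] /andP[h3 h4]; apply: ler_wpM2l => //; apply: lerD.
    by rewrite ler_norml; apply/andP; split; lra.
  by rewrite ler_norml; apply/andP; split; lra.
have Ib : a <= b <= b by apply/andP; split; lra.
have Ia : a <= a <= b by apply/andP; split; lra.
have Ix : c <= x <= d by apply/andP; split; lra.
have Iy : a <= y <= b by apply/andP; split; lra.
have Ic : c <= c <= d by apply/andP; split; lra.
have Id : c <= d <= d by apply/andP; split; lra.
have [h1 _] := H b x Ib Ix; have {}h1 := le_trans h1 (near_le _ _ Ib Ix).
have [h2 _] := H a x Ia Ix; have {}h2 := le_trans h2 (near_le _ _ Ia Ix).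
have [_ h3] := H y c Iy Ic; have {}h3 := le_trans h3 (near_le _ _ Iy Ic).
have [_ h4] := H y d Iy Id; have {}h4 := le_trans h4 (near_le _ _ Iy Id).
have E1 : `|u b x - u a x - k * (b - a)| <= 2 * (e * L).
  move: h1 h2; clear; rewrite !ler_norml => /andP[? ?] /andP[? ?]; apply/andP; split; lra.
have E2 : `|v y c - v y d + k * (d - c)| <= 2 * (e * L).
  move: h3 h4; clear; rewrite !ler_norml => /andP[? ?] /andP[? ?]; apply/andP; split; lra.
have -> : circulation a b c d = (u b x - u a x - k * (b - a)) * (d - c) + (v y c - v y d + k * (d - c)) * (b - a).
  rewrite /circulation; move: hx hy => /=; lra.
apply: (le_trans (ler_normD _ _)); rewrite !normrM.
rewrite (gtr0_norm (x := d - c)) ?subr_gt0// (gtr0_norm (x := b - a)) ?subr_gt0//.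
have -> : 2 * e * L ^+ 2 = 2 * (e * L) * (d - c) + 2 * (e * L) * (b - a) by rewrite /L; ring.
by apply: lerD; apply: ler_wpM2r => //; rewrite subr_ge0 ltW.
Qed.

(** One of the four quarters of a rectangle carries at least a quarter of the
    circulation in absolute value. *)
Lemma circulation_quarter a c h k : exists p : R * R,
  (p.1 = a \/ p.1 = a + h / 2) /\ (p.2 = c \/ p.2 = c + k / 2) /\
  `|circulation a (a + h) c (c + k)| <=
    4 * `|circulation p.1 (p.1 + h / 2) p.2 (p.2 + k / 2)|.
Proof.
set X := circulation _ _ _ _.
set X1 := circulation a (a + h / 2) c (c + k / 2).
set X2 := circulation (a + h / 2) (a + h / 2 + h / 2) c (c + k / 2).
set X3 := circulation a (a + h / 2) (c + k / 2) (c + k / 2 + k / 2).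
set X4 := circulation (a + h / 2) (a + h / 2 + h / 2) (c + k / 2) (c + k / 2 + k / 2).
have XE : X = X1 + X2 + X3 + X4.
  rewrite /X /X1 /X2 /X3 /X4 /circulation -!addrA -!splitr !addrA.
  move: (prim M) => I; ring.
have [h1|h1] := leP `|X| (4 * `|X1|).
  by exists (a, c) => /=; split; [left|split; [left|]].
have [h2|h2] := leP `|X| (4 * `|X2|).
  by exists (a + h / 2, c) => /=; split; [right|split; [left|]].
have [h3|h3] := leP `|X| (4 * `|X3|).
  by exists (a, c + k / 2) => /=; split; [left|split; [right|]].
have [h4|h4] := leP `|X| (4 * `|X4|).
  by exists (a + h / 2, c + k / 2) => /=; split; [right|split; [right|]].
have := ler_normD (X1 + X2 + X3) X4; have := ler_normD (X1 + X2) X3; have := ler_normD X1 X2.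
rewrite -XE; lra.
Qed.

End Goursat.

(** Nested intervals of lengths [h / 2 ^ n], each one the left or the right half
    of the preceding one, have a common point. *)
Lemma bisection_limit (R : realType) (a : nat -> R) (h : R) : 0 < h ->
  (forall n, a n.+1 = a n \/ a n.+1 = a n + h / 2 ^+ n / 2) ->
  exists s, forall n, a n <= s <= a n + h / 2 ^+ n.
Proof.
move=> h0 ha.
have p0 n : 0 < h / 2 ^+ n by rewrite divr_gt0// exprn_gt0.
have pS n : h / 2 ^+ n.+1 = h / 2 ^+ n / 2 by rewrite exprS; field; rewrite expf_neq0.
have mono m n : (m <= n)%N -> a m <= a n /\ a n + h / 2 ^+ n <= a m + h / 2 ^+ m.
  move=> /subnK <-; elim: (n - m)%N => [|k [IH1 IH2]]; first by rewrite add0n.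
  rewrite addSn pS; have := p0 (k + m)%N; case: (ha (k + m)%N) => ->; split; lra.
have bd m n : a m <= a n + h / 2 ^+ n.
  have [/mono[h1 _]|/ltnW/mono[_ h1]] := leqP m n; have := p0 n; have := p0 m; lra.
exists (sup (range a)) => n; apply/andP; split.
  apply: ub_le_sup; last by exists n.
  by exists (a 0%N + h / 2 ^+ 0) => _ [m _ <-].
by apply: ge_sup; [exists (a 0%N); exists 0%N|move=> _ [m _ <-]].
Qed.

Lemma half_pow_lt (R : realType) (h e : R) : 0 < e -> exists n, h / 2 ^+ n < e.
Proof.
move=> e0; have [n hn] : exists n : nat, h / e < n%:R.
  by exists (Num.bound `|h / e|); apply: (le_lt_trans (ler_norm _)); exact: archi_boundP.
exists n; rewrite ltr_pdivrMr ?exprn_gt0// mulrC -ltr_pdivrMr//.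
by apply: (lt_trans hn); rewrite -natrX ltr_nat ltn_expl.
Qed.

Section GoursatTheorem.
Variable R : realType.
Variables (M : R) (u v : R -> R -> R) (a0 b0 c0 d0 : R).
Hypothesis cu : forall s, continuous (u s).
Hypothesis cv : forall t, continuous (v^~ t).
Hypotheses (aM : - M < a0) (bM : b0 < M) (cM : - M < c0) (dM : d0 < M).
Hypotheses (ab : a0 < b0) (cd : c0 < d0).
Hypothesis CR : forall s t, a0 <= s <= b0 -> c0 <= t <= d0 ->
  cauchy_riemann u v a0 b0 c0 d0 s t.

(** Goursat's theorem: the circulation around a rectangle vanishes.  If it did
    not, successive quarters would keep a circulation of order [4 ^ - n],
    contradicting circulation_local at their common point. *)
Lemma goursat : circulation M u v a0 b0 c0 d0 = 0.
Proof.
pose h := b0 - a0; pose k := d0 - c0.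
have h0 : 0 < h by rewrite subr_gt0.
have k0 : 0 < k by rewrite subr_gt0.
(* quarters at stage n are given by their lower left corners *)
pose circ n (p : R * R) := circulation M u v p.1 (p.1 + h / 2 ^+ n) p.2 (p.2 + k / 2 ^+ n).
have step n p : exists q : R * R,
    (q.1 = p.1 \/ q.1 = p.1 + h / 2 ^+ n / 2) /\ (q.2 = p.2 \/ q.2 = p.2 + k / 2 ^+ n / 2) /\
    `|circ n p| <= 4 * `|circ n.+1 q|.
  have [q [q1 [q2 q3]]] := circulation_quarter M u v p.1 p.2 (h / 2 ^+ n) (k / 2 ^+ n).
  exists q; do 2 split => //; apply: (le_trans q3).
  by rewrite /circ exprS invfM !mulrA (mulrAC h) (mulrAC k).
pose nxt n p := projT1 (cid (step n p)).
pose fix P n := if n is m.+1 then nxt m (P m) else (a0, c0).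
have PS n : [/\ (P n.+1).1 = (P n).1 \/ (P n.+1).1 = (P n).1 + h / 2 ^+ n / 2,
    (P n.+1).2 = (P n).2 \/ (P n.+1).2 = (P n).2 + k / 2 ^+ n / 2 &
    `|circ n (P n)| <= 4 * `|circ n.+1 (P n.+1)|].
  by rewrite /= /nxt; case: cid => q /= [? []].
have big n : `|circ 0%N (P 0%N)| <= 4 ^+ n * `|circ n (P n)|.
  elim: n => [|n IH]; first by rewrite expr0 mul1r.
  apply: (le_trans IH); rewrite exprSr -mulrA ler_pM2l ?exprn_gt0//.
  by case: (PS n).
have [s hs] := @bisection_limit R (fun n => (P n).1) h h0 (fun n => let: And3 x _ _ := PS n in x).
have [t ht] := @bisection_limit R (fun n => (P n).2) k k0 (fun n => let: And3 _ x _ := PS n in x).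
have pS n (x : R) : x / 2 ^+ n.+1 = x / 2 ^+ n / 2 by rewrite exprS; field; rewrite expf_neq0.
have inr n : [/\ a0 <= (P n).1, (P n).1 + h / 2 ^+ n <= b0, c0 <= (P n).2 & (P n).2 + k / 2 ^+ n <= d0].
  elim: n => [|n [i1 i2 i3 i4]]; first by rewrite /= !expr0 !divr1 /h /k; split; lra.
  have [j1 j2 _] := PS n; rewrite !pS.
  have p1 : 0 < h / 2 ^+ n by rewrite divr_gt0// exprn_gt0.
  have p2 : 0 < k / 2 ^+ n by rewrite divr_gt0// exprn_gt0.
  move: j1 j2 p1 p2 i1 i2 i3 i4; rewrite /=.
  move: (h / 2 ^+ n) (k / 2 ^+ n) (P n).1 (P n).2 (nxt n (P n)).1 (nxt n (P n)).2; clear.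
  by move=> h k x y x' y' [->|->] [->|->] ? ? ? ? ? ?; split; lra.
have Is : a0 <= s <= b0.
  by have := hs 0%N; rewrite /= expr0 divr1 /h => /andP[? ?]; apply/andP; split; lra.
have It : c0 <= t <= d0.
  by have := ht 0%N; rewrite /= expr0 divr1 /k => /andP[? ?]; apply/andP; split; lra.
have [A [B HAB]] := CR Is It.
have circ0 : circ 0%N (P 0%N) = circulation M u v a0 b0 c0 d0.
  by rewrite /circ /= !expr0 !divr1 /h /k !(addrC _ (_ - _)) !subrK.
rewrite -circ0; apply/eqP; rewrite -normr_le0; apply/ler_addgt0Pr => e e0; rewrite add0r.
pose L := h + k; have L0 : 0 < L by rewrite addr_gt0.
(* with this error at stage n, 4 ^ n times the local bound is exactly e *)
have e'0 : 0 < e / (2 * L ^+ 2) by rewrite divr_gt0// mulr_gt0// exprn_gt0.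
have [dl dl0 Hdl] := HAB _ e'0.
have [n hn] := half_pow_lt L dl0.
have hn1 : h / 2 ^+ n < dl.
  by apply: le_lt_trans hn; rewrite ler_pM2r ?invr_gt0 ?exprn_gt0// /L lerDl ltW.
have hn2 : k / 2 ^+ n < dl.
  by apply: le_lt_trans hn; rewrite ler_pM2r ?invr_gt0 ?exprn_gt0// /L lerDr ltW.
have loc : `|circ n (P n)| <= 2 * (e / (2 * L ^+ 2)) * (L / 2 ^+ n) ^+ 2.
  have p1 : 0 < h / 2 ^+ n by rewrite divr_gt0// exprn_gt0.
  have p2 : 0 < k / 2 ^+ n by rewrite divr_gt0// exprn_gt0.
  have -> : L / 2 ^+ n = h / 2 ^+ n + k / 2 ^+ n by rewrite /L mulrDl.
  have := inr n; have := hs n; have := ht n; rewrite /circ /=.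
  have := ltW e'0; move: p1 p2 hn1 hn2 Hdl.
  move: (h / 2 ^+ n) (k / 2 ^+ n) (P n).1 (P n).2 (e / _) => h' k' x y e'.
  move=> p1 p2 hn1 hn2 Hdl e'' /andP[t1 t2] /andP[s1 s2] [i1 i2 i3 i4].
  have -> : h' + k' = (x + h' - x) + (y + k' - y) by ring.
  clear -cu cv aM bM cM dM p1 p2 hn1 hn2 Hdl e'' t1 t2 s1 s2 i1 i2 i3 i4.
  apply: (@circulation_local R M u v a0 b0 c0 d0 cu cv aM bM cM dM A B e' x (x + h') y (y + k') s t) => //.
  - by rewrite ltrDl.
  - by rewrite ltrDl.
  - by rewrite s1.
  - by rewrite t1.
  move=> s' t' /andP[? ?] /andP[? ?]; apply: Hdl.
  - by apply/andP; split; lra.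
  - by apply/andP; split; lra.
  - by rewrite ltr_norml; apply/andP; split; lra.
  - by rewrite ltr_norml; apply/andP; split; lra.
apply: (le_trans (big n)).
have -> : e = 4 ^+ n * (2 * (e / (2 * L ^+ 2)) * (L / 2 ^+ n) ^+ 2).
  have -> : (4 : R) ^+ n = (2 ^+ n) ^+ 2 by rewrite -exprM mulnC exprM; congr (_ ^+ n); ring.
  field; rewrite expf_neq0// gt_eqF//.
by rewrite ler_pM2l ?exprn_gt0.
Qed.

End GoursatTheorem.

(** * The maximum modulus principle *)

Section Polar.
Variable R : realType.
Implicit Types (s t e r : R).

(** [e ^ (it)]. *)
Definition cis t : Cplx R := (cos t +i* sin t)%C.

Lemma cmod_cis t : cmod (cis t) = 1.
Proof. by apply: complexI; rewrite -cmodE normc_def /= cos2Dsin2 sqrtr1. Qed.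

Lemma cis_approx t0 e : 0 < e -> exists2 d, 0 < d & forall t, `|t - t0| < d ->
  cmod (cis t - cis t0 - cis t0 * (0 +i* (t - t0))%C) <= e * `|t - t0|.
Proof.
move=> e0; have e20 : 0 < e / 2 by lra.
have [d1 d10 h1] := is_derive_approx (is_derive_cos t0) e20.
have [d2 d20 h2] := is_derive_approx (is_derive_sin t0) e20.
exists (Num.min d1 d2); first by rewrite lt_min d10.
move=> t; rewrite lt_min => /andP[/h1 {}h1 /h2 {}h2].
apply: (le_trans (cmod_le_ReIm _)) => /=.
have -> : cos t - cos t0 - (cos t0 * 0 - sin t0 * (t - t0)) = cos t - cos t0 - - sin t0 * (t - t0) by ring.
have -> : sin t - sin t0 - (cos t0 * (t - t0) + sin t0 * 0) = sin t - sin t0 - cos t0 * (t - t0) by ring.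
by have := lerD h1 h2; rewrite -mulrDl -splitr.
Qed.

Lemma cis_lip t0 : exists2 d, 0 < d & forall t, `|t - t0| < d ->
  cmod (cis t - cis t0) <= 2 * `|t - t0|.
Proof.
have [d d0 h] := @cis_approx t0 1 ltr01; exists d => // t /h {}h.
have := cmodD (cis t - cis t0 - cis t0 * (0 +i* (t - t0))%C) (cis t0 * (0 +i* (t - t0))%C).
rewrite subrK => /le_trans; apply.
have : cmod (cis t0 * (0 +i* (t - t0))%C) <= `|t - t0|.
  by rewrite cmodM cmod_cis mul1r; apply: (le_trans (cmod_le_ReIm _)); rewrite /= normr0 add0r.
move=> h'; lra.
Qed.

Lemma cis_continuous : continuous cis.
Proof.
move=> t0; apply/cvg_cplxP => e e0; have [d d0 h] := cis_lip t0.
apply/nbhs_ballP; exists (Num.min d (e / 2)); first by rewrite /= lt_min d0 /=; lra.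
move=> t; rewrite /= distrC lt_min => /andP[/h h1 h2].
apply: (le_lt_trans h1); lra.
Qed.

(** [e ^ (s + it)]. *)
Definition cpolar s t : Cplx R := (expR s)%:C%C * cis t.

Lemma cmod_cpolar s t : cmod (cpolar s t) = expR s.
Proof. by rewrite cmodM cmodR cmod_cis mulr1 gtr0_norm ?expR_gt0. Qed.

(** The function [e ^ (s + it)] is its own derivative with respect to [s + it]. *)
Lemma cpolar_approx s0 t0 e : 0 < e -> exists2 d, 0 < d & forall s t,
  `|s - s0| < d -> `|t - t0| < d ->
  cmod (cpolar s t - cpolar s0 t0 - cpolar s0 t0 * ((s - s0) +i* (t - t0))%C)
    <= e * (`|s - s0| + `|t - t0|).
Proof.
move=> e0; pose K := expR s0; have K0 : 0 < K := expR_gt0 _.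
pose e1 := e / (1 + K).
have e10 : 0 < e1 by rewrite divr_gt0//; lra.
have [d1 d10 h1] := is_derive_approx (is_derive_expR s0) e10.
have [d2 d20 h2] := cis_approx t0 e10.
have [d3 d30 h3] := cis_lip t0.
exists (Num.min (Num.min d1 d2) (Num.min d3 (e1 / 2))).
  by rewrite !lt_min d10 d20 d30 /=; lra.
move=> s t; rewrite !lt_min => /andP[/andP[/h1 {}h1 _] _] /andP[/andP[_ /h2 {}h2] /andP[/h3 {}h3 h4]].
have -> : cpolar s t - cpolar s0 t0 - cpolar s0 t0 * ((s - s0) +i* (t - t0))%C =
  (expR s - expR s0 - K * (s - s0))%:C%C * cis t
  + K%:C%C * (cis t - cis t0 - cis t0 * (0 +i* (t - t0))%C)
  + (K * (s - s0))%:C%C * (cis t - cis t0).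
  have -> : ((s - s0) +i* (t - t0))%C = (s - s0)%:C%C + (0 +i* (t - t0))%C :> Cplx R.
    by apply/eqP; rewrite eq_complex /= addr0 add0r !eqxx.
  rewrite /cpolar !rmorphB !rmorphM !rmorphB /= -/K.
  move: (cis t) (cis t0) (0 +i* _)%C (_%:C)%C (K%:C)%C (s%:C)%C (s0%:C)%C => *; ring.
apply: (le_trans (cmodD _ _)); apply: (le_trans (lerD (cmodD _ _) (lexx _))).
rewrite !cmodM cmod_cis !cmodR mulr1 normrM (gtr0_norm K0).
have i2 : K * cmod (cis t - cis t0 - cis t0 * (0 +i* (t - t0))%C) <= K * (e1 * `|t - t0|).
  by rewrite ler_pM2l.
have i3 : K * `|s - s0| * cmod (cis t - cis t0) <= K * `|s - s0| * e1.
  by apply: ler_wpM2l; [rewrite mulr_ge0// ltW|lra].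
have -> : e = e1 * (1 + K) by rewrite /e1 divfK// gt_eqF//; lra.
apply: (le_trans (lerD (lerD h1 i2) i3)).
have : 0 <= e1 * `|t - t0| by rewrite mulr_ge0// ltW.
clear; lra.
Qed.

End Polar.

Section MaximumModulus.
Variable R : realType.
Implicit Types (a w z : Cplx R) (e r B : R) (g : Cplx R -> Cplx R).

(* Capping [s] at 0 keeps [a + r e ^ (s + it)] in the closed disc for all real
   [s], so that one-variable functions of [s] are continuous on the whole line. *)
Lemma clamp_continuous : continuous (fun s : R => Num.min s 0).
Proof.
move=> s; apply/(@cvgrPdist_lt R R^o _ _ (nbhs_filter s)) => e e0.
apply/nbhs_ballP; exists e => //= t; rewrite -ball_normE /=; apply: le_lt_trans.
by case: (leP s 0) => h1; case: (leP t 0) => h2; rewrite ?subrr ?normr0 ?subr0 ?sub0r ?normrN//;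
  rewrite ?(ler0_norm h1) ?(gtr0_norm h1) ?(ler0_norm h2) ?(gtr0_norm h2) ler_normr; apply/orP;
  [right|left]; lra.
Qed.

Lemma Re_continuous : continuous (fun z : Cplx R => complex.Re z : R).
Proof.
move=> z; apply/(@cvgrPdist_lt R R^o _ _ (nbhs_filter z)) => e e0.
apply: filterS (near_cplx z e0) => w; apply: le_lt_trans.
by rewrite -raddfB cmodB; exact: Re_cmod.
Qed.

Lemma Im_continuous : continuous (fun z : Cplx R => complex.Im z : R).
Proof.
move=> z; apply/(@cvgrPdist_lt R R^o _ _ (nbhs_filter z)) => e e0.
apply: filterS (near_cplx z e0) => w; apply: le_lt_trans.
by rewrite -raddfB cmodB; exact: Im_cmod.
Qed.

Lemma expR_clamp_continuous :
  continuous (fun s : R => ((expR (Num.min s 0))%:C%C : Cplx R)).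
Proof.
move=> s; apply/cvg_cplxP => e e0.
have h : {for s, continuous (fun s : R => expR (Num.min s 0))}.
  apply: (@continuous_comp _ _ _ (fun s : R => Num.min s 0) expR).
    exact: clamp_continuous.
  exact: continuous_expR.
have := iffLR (@cvgrPdist_lt R R^o _ _ (nbhs_filter s) _ _) h e e0.
by apply: filterS => s'; rewrite -rmorphB cmodR distrC.
Qed.

Lemma affine_cvg (T : Type) (F : set_system T) (FF : Filter F) (f : T -> Cplx R) (l a c : Cplx R) :
  f @ F --> l -> (fun t => a + c * f t) @ F --> a + c * l.
Proof.
move=> /cvg_cplxP fl; apply/cvg_cplxP => e e0.
have c0 : 0 < cmod c + 1 by have := cmod_ge0 c; lra.
apply: filterS (fl (e / (cmod c + 1)) (divr_gt0 e0 c0)) => t ht.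
rewrite (_ : a + c * f t - (a + c * l) = c * (f t - l)); last by ring.
rewrite cmodM; apply: (@le_lt_trans _ _ ((cmod c + 1) * cmod (f t - l))).
  by apply: ler_wpM2r; [exact: cmod_ge0|rewrite lerDl].
by rewrite mulrC -ltr_pdivlMr.
Qed.

(** The chain rule for [g (a + r e ^ (s + it))] with respect to [s + it]. *)
Lemma cdiff_cpolar g a r s0 t0 : 0 < r -> s0 <= 0 ->
  cdiff g (a + r%:C%C * cpolar s0 t0) ->
  exists k l : R, forall e, 0 < e -> exists2 d, 0 < d & forall s t,
  `|s - s0| < d -> `|t - t0| < d ->
  cmod (g (a + r%:C%C * cpolar s t) - g (a + r%:C%C * cpolar s0 t0)
        - (k +i* l)%C * ((s - s0) +i* (t - t0))%C)
    <= e * (`|s - s0| + `|t - t0|).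
Proof.
move=> r0 s00 [D hD].
pose kp : Cplx R := D * (r%:C%C * cpolar s0 t0).
exists (complex.Re kp), (complex.Im kp) => e e0.
pose m := cmod D * r; have m0 : 0 <= m by rewrite mulr_ge0 ?cmod_ge0// ltW.
pose e1 := e / (4 * r); have e10 : 0 < e1 by rewrite divr_gt0//; lra.
pose e2 := Num.min 1 (e / (2 * (m + 1))).
have e20 : 0 < e2 by rewrite lt_min ltr01 /= divr_gt0//; lra.
have e21 : e2 <= 1 by rewrite ge_min lexx.
have e2m : m * e2 <= e / 2.
  have : e2 <= e / (2 * (m + 1)) by rewrite ge_min lexx orbT.
  move=> /(ler_wpM2l m0)/le_trans; apply.
  rewrite mulrA ler_pdivrMr; last lra.
  rewrite (_ : e / 2 * (2 * (m + 1)) = m * e + e); last by field.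
  by rewrite lerDl ltW.
have [d1 d10 h1] := hD _ e10.
have [d2 d20 h2] := cpolar_approx s0 t0 e20.
exists (Num.min d2 (d1 / (4 * r))).
  by rewrite lt_min d20 /= divr_gt0//; lra.
move=> s t; rewrite !lt_min => /andP[/h2 {}h2 sd] /andP[/h2 {}h2 td].
set N := `|s - s0| + `|t - t0| in h2 *.
set h : Cplx R := (_ +i* _)%C in h2 *.
have Nh : cmod h <= N by exact: cmod_le_ReIm.
have N0 : 0 <= N by rewrite addr_ge0.
have -> : (complex.Re kp +i* complex.Im kp)%C = kp by case: (kp).
set w := a + _; set w0 := a + _.
have ww : w - w0 = r%:C%C * (cpolar s t - cpolar s0 t0) by rewrite /w /w0; ring.
set sg := cpolar s t - cpolar s0 t0 - cpolar s0 t0 * h in h2.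
have wle : cmod (w - w0) <= 2 * r * N.
  rewrite ww cmodM cmodR gtr0_norm// (_ : 2 * r * N = r * (2 * N)); last by ring.
  rewrite ler_pM2l//.
  have -> : cpolar s t - cpolar s0 t0 = sg + cpolar s0 t0 * h by rewrite /sg; ring.
  apply: (le_trans (cmodD _ _)); rewrite cmodM cmod_cpolar.
  have E1 : expR s0 <= 1 by rewrite expR_le1.
  have := ler_wpM2r N0 e21; have := ler_pM (expR_ge0 s0) (cmod_ge0 h) E1 Nh.
  move: h2; clear; lra.
have wd : cmod (w - w0) < d1.
  apply: (le_lt_trans wle).
  have : N < 2 * (d1 / (4 * r)) by rewrite /N; move: sd td; clear; lra.
  rewrite -(ltr_pM2l (x := 2 * r)); last lra.
  move/lt_le_trans; apply; rewrite le_eqVlt; apply/orP; left; apply/eqP.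
  by field; rewrite gt_eqF.
have := h1 _ wd; set rho := g w - g w0 - D * (w - w0) => hrho.
have -> : g w - g w0 - kp * h = D * (r%:C%C * sg) + rho.
  by rewrite /rho ww /kp /sg; ring.
apply: (le_trans (cmodD _ _)); rewrite 2!cmodM cmodR (gtr0_norm r0) mulrA -/m.
have i1 : m * cmod sg <= e / 2 * N.
  apply: (le_trans (ler_wpM2l m0 h2)); rewrite mulrA; exact: ler_wpM2r.
have i2 : cmod rho <= e / 2 * N.
  apply: (le_trans hrho); apply: (le_trans (ler_wpM2l (ltW e10) wle)).
  rewrite mulrA (_ : e1 * (2 * r) = e / 2)// /e1; field; rewrite gt_eqF//.
by have := lerD i1 i2; rewrite -mulrDl -splitr.
Qed.

(** The mean value inequality at the centre of a disc.  In the logarithmic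
    coordinates [a + r e ^ (s + it)] the two horizontal sides of the rectangle
    [s1 <= s <= 0], [0 <= t <= 2 pi] cancel by periodicity, so the real part of
    [g] has the same mean on the circle [s = 0] as on the small circle
    [s = s1]. *)
Lemma Re_center_le g a r B : 0 < r ->
  (forall w, cmod (w - a) <= r -> cdiff g w) ->
  (forall w, cmod (w - a) = r -> complex.Re (g w) <= B) ->
  complex.Re (g a) <= B.
Proof.
move=> r0 dg gB; rewrite leNgt; apply/negP => aB.
have [rho rho0 hrho] : exists2 d, 0 < d & forall w, cmod (w - a) < d -> B < complex.Re (g w).
  have da : cdiff g a by apply: dg; rewrite subrr cmod0 ltW.
  have /continuous_comp /(_ (@Re_continuous (g a))) := cdiff_continuous da.
  move=> /(@cvgrPdist_lt R R^o _ _ (nbhs_filter a)) /(_ (complex.Re (g a) - B)).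
  rewrite subr_gt0 => /(_ aB)/nbhs_cplxP[d d0 hd]; exists d => // w /hd /=.
  by rewrite ltr_norml => /andP[_]; rewrite ltrD2l ltrN2.
have [s1 s10 hs1] : exists2 s1 : R, s1 < 0 & r * expR s1 < rho.
  pose x := Num.min (rho / (2 * r)) (1 / 2).
  have x0 : 0 < x by rewrite lt_min; apply/andP; split; [rewrite divr_gt0//; lra|lra].
  exists (ln x); first by rewrite ln_lt0// x0 /= gt_min; apply/orP; right; lra.
  rewrite lnK ?posrE//.
  have : x <= rho / (2 * r) by rewrite ge_min lexx.
  move/(ler_wpM2l (ltW r0))/le_lt_trans; apply.
  rewrite (_ : r * _ = rho / 2); last by field; rewrite gt_eqF.
  lra.
pose P s t := a + r%:C%C * cpolar (Num.min s 0) t.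
have Pa s t : cmod (P s t - a) = r * expR (Num.min s 0).
  by rewrite /P addrAC subrr add0r cmodM cmodR cmod_cpolar gtr0_norm.
have Pr s t : cmod (P s t - a) <= r.
  by rewrite Pa -[leRHS]mulr1 ler_pM2l// expR_le1 ge_min lexx orbT.
have dP s t : cdiff g (P s t) by apply: dg.
have cP1 s : continuous (P s).
  move=> t; rewrite /P /cpolar.
  have := @affine_cvg _ _ (nbhs_filter t) _ _ a (r%:C%C * (expR (Num.min s 0))%:C%C) (@cis_continuous R t).
  by under eq_fun do rewrite -mulrA; rewrite -mulrA.
have cP2 t : continuous (P^~ t).
  move=> s; rewrite /P /cpolar.
  have := @affine_cvg _ _ (nbhs_filter s) _ _ a (r%:C%C * cis t) (@expR_clamp_continuous s).
  by under eq_fun do rewrite mulrAC -mulrA; rewrite mulrAC -mulrA.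
pose u s t := complex.Re (g (P s t)); pose v s t := complex.Im (g (P s t)).
have cu s : continuous (u s).
  move=> t; apply: continuous_comp; last exact: Re_continuous.
  by apply: continuous_comp; [exact: cP1|exact: cdiff_continuous].
have cv t : continuous (v^~ t).
  move=> s; apply: continuous_comp; last exact: Im_continuous.
  by apply: (@continuous_comp _ _ _ (P^~ t) g); [exact: cP2|exact: cdiff_continuous].
pose T : R := pi *+ 2.
have T0 : 0 < T by rewrite /T mulrn_wgt0// pi_gt0.
pose M := T + 1 - s1.
have M1 : - M < s1 by rewrite /M; lra.
have M2 : 0 < M by rewrite /M; lra.
have M3 : - M < 0 by rewrite /M; lra.
have M4 : T < M by rewrite /M; lra.
have CR s t : s1 <= s <= 0 -> 0 <= t <= T -> cauchy_riemann u v s1 0 0 T s t.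
  move=> /andP[_ s0] _; have ms : Num.min s 0 = s by apply/min_idPl.
  have ds := dP s t; rewrite /P ms in ds.
  have [k [l H]] := cdiff_cpolar r0 s0 ds.
  exists k, l => e e0; have [d d0 {}H] := H e e0; exists d => // s' t' /andP[_ s'0] _ sd td.
  have ms' : Num.min s' 0 = s' by apply/min_idPl.
  have := H _ _ sd td; rewrite /u /v /P ms ms'.
  move: (g _) (g _) => [x1 y1] [x2 y2] {}H; split.
    apply: le_trans H; apply: le_trans (Re_cmod _); rewrite /= le_eqVlt; apply/orP; left; apply/eqP.
    by congr `|_|; ring.
  apply: le_trans H; apply: le_trans (Im_cmod _); rewrite /= le_eqVlt; apply/orP; left; apply/eqP.
  by congr `|_|; ring.
(* the horizontal sides t = 0 and t = 2 pi cancel *)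
have per : v^~ 0 = v^~ T.
  by apply/funext => s; rewrite /v /P /cpolar /cis cos0 sin0 /T cos2pi sin2pi.
have := goursat cu cv M1 M2 M3 M4 s10 T0 CR.
rewrite /circulation -per addrK => H.
have [x /andP[x0 xT] hx] := prim_MVT (@cu 0) (@cu s1) M3 T0 M4.
have swap (x1 x2 x3 x4 : R) : x1 - x2 - (x3 - x4) = x1 - x3 - (x2 - x4) by ring.
have : (u 0 x - u s1 x) * (T - 0) = 0 by rewrite -hx swap; exact: H.
move/eqP; rewrite mulf_eq0 subr0 (gt_eqF T0) orbF subr_eq0 => /eqP.
have : u 0 x <= B by apply: gB; rewrite Pa min_l// expR0 mulr1.
have : B < u s1 x by apply: hrho; rewrite Pa min_l// ltW.
by move=> h1 h2 h3; move: h1; rewrite -h3 ltNge h2.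
Qed.

End MaximumModulus.

Section MaximumModulusDisc.
Variable R : realType.
Implicit Types (a b w z : Cplx R) (e r B : R) (g : Cplx R -> Cplx R) (s : seq (Cplx R)).

Lemma disc_max (f : Cplx R -> R) a r : 0 <= r ->
  (forall w, cmod (w - a) <= r -> {for w, continuous f}) ->
  exists2 p, cmod (p - a) <= r & forall w, cmod (w - a) <= r -> f w <= f p.
Proof.
move=> r0 cf; have [||p] := @compact_EVT_max _ R f (disc a r) _ (@disc_compact R a r).
- by exists a; rewrite /disc /= subrr cmod0.
- by apply: continuous_in_subspaceT => w; rewrite inE; exact: cf.
by rewrite inE => pa pmax; exists p => // w wa; apply: pmax; rewrite inE.
Qed.

Lemma cmod_sqr z : cmod z ^+ 2 = complex.Re z ^+ 2 + complex.Im z ^+ 2.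
Proof.
apply: complexI; rewrite rmorphXn /= -cmodE -(add_Re2_Im2 (z : R[i])).
by [].
Qed.

(** From the centre to arbitrary points of the disc.  An interior maximum of
    [Re g] exceeding [B] persists for [Re g + e |w - a| ^ 2] with small
    [e > 0]; around the new maximum point [p], subtracting the strictly
    subharmonic term leaves an affine correction of [g] that violates
    Re_center_le. *)
Lemma Re_disc_le g a r B : 0 < r ->
  (forall w, cmod (w - a) <= r -> cdiff g w) ->
  (forall w, cmod (w - a) = r -> complex.Re (g w) <= B) ->
  forall w, cmod (w - a) <= r -> complex.Re (g w) <= B.
Proof.
move=> r0 dg gB w1 w1a; rewrite leNgt; apply/negP => Bw1.
have r20 : 0 < r ^+ 2 by rewrite exprn_gt0.
(* e r ^ 2 is half of the excess Re (g w1) - B *)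
pose e := (complex.Re (g w1) - B) / (2 * r ^+ 2).
have e0 : 0 < e by rewrite divr_gt0 ?subr_gt0// mulr_gt0.
have er : 2 * (e * r ^+ 2) = complex.Re (g w1) - B by rewrite /e; field; rewrite gt_eqF.
pose phi w := complex.Re (g w) + e * cmod (w - a) ^+ 2.
have [|p pa pmax] := @disc_max phi a r (ltW r0).
  move=> w wa; apply: (@cvgD R R^o _ _ (nbhs_filter w)).
    have := cdiff_continuous (dg w wa) => /continuous_comp; apply.
    exact: Re_continuous.
  apply: (@cvgM R _ _ (nbhs_filter w)); first exact: cvg_cst.
  by apply: (@cvgM R _ _ (nbhs_filter w)); exact: dist_continuous.
have w1p : complex.Re (g w1) <= phi p.
  by apply: le_trans (pmax w1 w1a); rewrite /phi lerDl mulr_ge0 ?(ltW e0)// exprn_ge0// cmod_ge0.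
have pr : cmod (p - a) < r.
  rewrite lt_neqAle pa andbT; apply/eqP => par.
  by have := gB p par; move: w1p er Bw1; rewrite /phi par; clear; lra.
pose rho := r - cmod (p - a); have rho0 : 0 < rho by rewrite subr_gt0.
have sub w : cmod (w - p) <= rho -> cmod (w - a) <= r.
  by move=> wp; have := cmod_dist w p a; move: wp; rewrite /rho; clear; lra.
(* |w - a| ^ 2 = |p - a| ^ 2 + Re (c (w - p)) / e + rho ^ 2 when |w - p| = rho *)
pose c : Cplx R := ((2 * e) * complex.Re (p - a) -i* ((2 * e) * complex.Im (p - a)))%C.
have dg2 w : cmod (w - p) <= rho -> cdiff (fun w => g w + c * (w - p)) w.
  move=> wp; apply: cdiffD; first by apply: dg; exact: sub.
  apply: cdiffM; first exact: cdiff_cst.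
  by apply: cdiffD; [exact: cdiff_id|exact: cdiff_cst].
have := @Re_center_le R _ p rho (complex.Re (g p) - e * rho ^+ 2) rho0 dg2.
rewrite subrr mulr0 addr0; move=> Hc.
have : complex.Re (g p) <= complex.Re (g p) - e * rho ^+ 2.
  apply: Hc => w wp.
  have wa : cmod (w - a) <= r by apply: sub; rewrite wp.
  have := pmax w wa; rewrite /phi !cmod_sqr -wp cmod_sqr /c.
  move: (g w) (g p) => [gw1 gw2] [gp1 gp2]; move: e {er e0 c phi pmax w1p dg2}; clear.
  case: w p a => [w1 w2] [p1 p2] [a1 a2] e /=; lra.
by have := mulr_gt0 e0 (exprn_gt0 2 rho0); clear; lra.
Qed.

(** The real part of a rotated function: [c (g w) = |g w|] with [|c| = 1]. *)
Lemma cmod_disc_le g a r B : 0 < r ->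
  (forall w, cmod (w - a) <= r -> cdiff g w) ->
  (forall w, cmod (w - a) = r -> cmod (g w) <= B) ->
  forall w, cmod (w - a) <= r -> cmod (g w) <= B.
Proof.
move=> r0 dg gB w wa; have [gw0|gw0] := eqVneq (g w) 0.
  have : cmod (a + r%:C%C - a) = r by rewrite addrAC subrr add0r cmodR gtr0_norm.
  by move=> /gB; apply: le_trans; rewrite gw0 cmod0 cmod_ge0.
pose c : Cplx R := (cmod (g w))%:C%C / g w.
have c1 : cmod c = 1.
  by rewrite cmodM cmodV cmodR ger0_norm ?cmod_ge0// divff// cmod_eq0.
have := @Re_disc_le (fun z => c * g z) a r B r0.
have -> : cmod (g w) = complex.Re (c * g w) by rewrite /c divfK.
apply=> // z za; first by apply: cdiffM; [exact: cdiff_cst|exact: dg].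
apply: (le_trans (ler_norm _)); apply: (le_trans (Re_cmod _)).
by rewrite cmodM c1 mul1r; exact: gB.
Qed.

Lemma bernoulli (x : R) n : 0 <= x -> 1 + n%:R * x <= (1 + x) ^+ n.
Proof.
move=> x0; elim: n => [|n IH]; first by rewrite mul0r addr0 expr0.
have x1 : 0 <= 1 + x by lra.
rewrite exprS; apply: le_trans (ler_wpM2l x1 IH).
have : 0 <= n%:R * x ^+ 2 by rewrite mulr_ge0// sqr_ge0.
rewrite -natr1; move: (n%:R) => m; nra.
Qed.

Lemma le_of_pow_le (x y P Q : R) : 0 <= x -> 0 <= y -> 0 < P ->
  (forall n, x ^+ n * P <= y ^+ n * Q) -> x <= y.
Proof.
move=> x0 y0 P0 H; rewrite leNgt; apply/negP => yx.
have [yE|y0'] := eqVneq y 0.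
  by have := H 1%N; rewrite !expr1 yE mul0r leNgt mulr_gt0// -yE.
have {}y0 : 0 < y by rewrite lt_def y0'.
pose h := x / y - 1; have h0 : 0 < h by rewrite subr_gt0 ltr_pdivlMr// mul1r.
have [n hn] : exists n : nat, Q / P / h < n%:R.
  by exists (Num.bound `|Q / P / h|); apply: (le_lt_trans (ler_norm _)); exact: archi_boundP.
have := bernoulli n (ltW h0).
have -> : 1 + h = x / y by rewrite /h; ring.
have : (x / y) ^+ n <= Q / P.
  by rewrite expr_div_n ler_pdivrMr ?exprn_gt0// -mulrAC ler_pdivlMr// (mulrC Q).
move: hn; rewrite ltr_pdivrMr//; clear; lra.
Qed.

(** [g] is bounded on a punctured neighbourhood of [b]; [g b] is irrelevant. *)
Definition bounded_near g b := exists K d : R,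
  0 < d /\ forall w, w != b -> cmod (w - b) < d -> cmod (g w) <= K.

Lemma bounded_near_cdiff g b : cdiff g b -> bounded_near g b.
Proof.
move=> /cdiff_continuous /cvg_cplxP /(_ 1 ltr01) /nbhs_cplxP[d d0 h].
exists (1 + cmod (g b)), d; split=> // w _ /h /ltW wb.
by have := cmodD (g w - g b) (g b); rewrite subrK; move: wb; clear; lra.
Qed.

Lemma bounded_nearM g h b : bounded_near g b -> bounded_near h b ->
  bounded_near (fun w => g w * h w) b.
Proof.
move=> [K [d [d0 H]]] [K' [d' [d'0 H']]].
exists (K * K'), (Num.min d d'); rewrite lt_min d0 d'0; split=> // w wb.
rewrite lt_min => /andP[/(H _ wb) h1 /(H' _ wb) h2].
by rewrite cmodM ler_pM ?cmod_ge0.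
Qed.

Lemma bounded_nearX g b n : bounded_near g b -> bounded_near (fun w => g w ^+ n) b.
Proof.
move=> [K [d [d0 H]]]; exists (K ^+ n), d; split=> // w wb /(H _ wb) h.
by rewrite cmodX lerXn2r ?nnegrE ?cmod_ge0// (le_trans (cmod_ge0 _) h).
Qed.

(** A double zero makes a locally bounded function differentiable, with
    derivative 0. *)
Lemma cdiff_sqr_bounded h b : bounded_near h b -> cdiff (fun w => (w - b) ^+ 2 * h w) b.
Proof.
move=> [K [d [d0 H]]]; exists 0 => e e0.
pose K1 := `|K| + 1; have K10 : 0 < K1 by rewrite ltr_wpDl.
exists (Num.min d (e / K1)); first by rewrite lt_min d0 divr_gt0.
move=> w; rewrite lt_min => /andP[wd we].
rewrite mul0r subr0 subrr expr0n mul0r subr0.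
have [->|wb] := eqVneq w b; first by rewrite subrr expr0n mul0r cmod0 mulr0.
have hw : cmod (h w) <= K1.
  by apply: (le_trans (H _ wb wd)); apply: (le_trans (ler_norm _)); rewrite lerDl.
rewrite cmodM cmodX expr2 -mulrA mulrC; apply: ler_wpM2r; first exact: cmod_ge0.
have -> : e = e / K1 * K1 by rewrite divfK// gt_eqF.
by apply: ler_pM; rewrite ?cmod_ge0// ltW.
Qed.

(** The maximum modulus principle survives finitely many points near which [g]
    is merely bounded: it holds for [g ^ n * \prod (w - b) ^ 2], which is
    differentiable at these points too, and [n] is arbitrary. *)
Lemma cmod_disc_le_except g a r B s : 0 < r -> 0 <= B ->
  (forall w, cmod (w - a) <= r -> w \notin s -> cdiff g w) ->
  (forall b, b \in s -> bounded_near g b) ->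
  (forall b, b \in s -> cmod (b - a) < r) ->
  (forall w, cmod (w - a) = r -> cmod (g w) <= B) ->
  forall w, cmod (w - a) <= r -> w \notin s -> cmod (g w) <= B.
Proof.
move=> r0 B0 dg bg sr gB w wa ws.
pose Q w := \prod_(b <- s) (w - b) ^+ 2.
have dQ (s' : seq (Cplx R)) z : cdiff (fun w => \prod_(b <- s') (w - b) ^+ 2) z.
  apply: cdiff_prod => b; apply: cdiffX; apply: cdiffD; first exact: cdiff_id.
  exact: cdiff_cst.
apply: (@le_of_pow_le _ _ (cmod (Q w)) (\prod_(b <- s) (2 * r) ^+ 2)).
- exact: cmod_ge0.
- by [].
- rewrite cmod_gt0 /Q prodf_seq_neq0; apply/allP => b bs /=.
  by rewrite expf_neq0// subr_eq0; apply: contraNneq ws => ->.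
move=> n; rewrite -cmodX -cmodM.
apply: (@cmod_disc_le (fun w => g w ^+ n * Q w) a r) => // z za.
- have [zs|zs] := boolP (z \in s); last by apply: cdiffM; [apply: cdiffX; exact: dg|exact: dQ].
  have -> : (fun w => g w ^+ n * Q w) =
      (fun w => (w - z) ^+ 2 * (g w ^+ n * \prod_(b <- rem z s) (w - b) ^+ 2)).
    by apply/funext => x; rewrite /Q (big_rem z)//= mulrCA.
  apply: cdiff_sqr_bounded; apply: bounded_nearM; last exact: bounded_near_cdiff.
  by apply: bounded_nearX; exact: bg.
- rewrite cmodM cmodX; apply: ler_pM; rewrite ?exprn_ge0 ?cmod_ge0//.
    by rewrite lerXn2r ?nnegrE ?cmod_ge0// gB.
  rewrite /Q cmod_prod big_seq [leRHS]big_seq; apply: ler_prod => b bs.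
  rewrite cmod_ge0 cmodX lerXn2r ?nnegrE ?cmod_ge0//; first by rewrite mulr_ge0// ltW.
  have := cmod_dist z a b; have := sr b bs; rewrite (cmodB a b) za; clear; lra.
Qed.

Lemma prod_le_const (I : eqType) (s : seq I) (F : I -> R) c :
  (forall i, i \in s -> 0 <= F i <= c) -> \prod_(i <- s) F i <= c ^+ size s.
Proof.
elim: s => [|i s IH] H; first by rewrite big_nil expr0.
rewrite big_cons exprS; have /andP[F0 Fc] := H i (mem_head _ _).
apply: ler_pM => //.
  by rewrite big_seq; apply: prodr_ge0 => j js; have /andP[] : 0 <= F j <= c by apply: H; rewrite in_cons js orbT.
by apply: IH => j js; apply: H; rewrite in_cons js orbT.
Qed.

Lemma const_le_prod (I : eqType) (s : seq I) (F : I -> R) c : 0 <= c ->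
  (forall i, i \in s -> c <= F i) -> c ^+ size s <= \prod_(i <- s) F i.
Proof.
move=> c0; elim: s => [|i s IH] H; first by rewrite big_nil expr0.
rewrite big_cons exprS; apply: ler_pM => //; first exact: exprn_ge0.
  by apply: H; rewrite mem_head.
by apply: IH => j js; apply: H; rewrite in_cons js orbT.
Qed.

(** Dividing by k zeros in a disc of radius r / 5 and applying the maximum
    principle on the disc of radius r gains a factor 1/2 for each zero: a zero
    b and a point w of the small disc have [|w - b| <= 2 r / 5], while
    [|z - b| >= 4 r / 5] on the circle. *)
Lemma many_zeros g a r : 0 < r ->
  (forall w, cmod (w - a) <= r -> cdiff g w) ->
  (forall k, exists s, [/\ size s = k, uniq s &
     forall b, b \in s -> cmod (b - a) <= r / 5 /\ g b = 0]) ->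
  forall w, cmod (w - a) <= r / 5 -> g w = 0.
Proof.
move=> r0 dg hs w wa.
have [p pa pmax] : exists2 p, cmod (p - a) <= r & forall w, cmod (w - a) <= r -> cmod (g w) <= cmod (g p).
  apply: (@disc_max (fun w => cmod (g w))); first exact: ltW.
  move=> z za; have := cdiff_continuous (dg z za) => /continuous_comp; apply.
  have := @dist_continuous R 0 (g z); rewrite /continuous_at.
  by under [in X in X -> _]eq_fun do rewrite subr0; rewrite subr0.
set M := cmod (g p) in pmax.
have M0 : 0 <= M := cmod_ge0 _.
apply/eqP; apply: contraT => gw0.
have [k hk] : exists k, M / 2 ^+ k < cmod (g w) by apply: half_pow_lt; rewrite cmod_gt0.
have [s [sk us sz]] := hs k.
have ws : w \notin s by apply: contraNN gw0 => /sz[_ ->].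
pose P w := \prod_(b <- s) (w - b).
have dP (s' : seq (Cplx R)) z : cdiff (fun w => \prod_(b <- s') (w - b)) z.
  by apply: cdiff_prod => b; apply: cdiffD; [exact: cdiff_id|exact: cdiff_cst].
have P0 (s' : seq (Cplx R)) z : z \notin s' -> \prod_(b <- s') (z - b) != 0.
  move=> zs; rewrite prodf_seq_neq0; apply/allP => b bs /=.
  by rewrite subr_eq0; apply: contraNneq zs => ->.
have c0 : 0 < (4 * r / 5) ^+ k by rewrite exprn_gt0//; lra.
have : cmod (g w * (P w)^-1) <= M / (4 * r / 5) ^+ k.
  apply: (@cmod_disc_le_except (fun w => g w * (P w)^-1) a r _ s) => //.
  - by rewrite divr_ge0// ltW.
  - by move=> z za zs; apply: cdiffM; [exact: dg|apply: cdiffV; [exact: P0|exact: dP]].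
  - move=> b bs; have [ba gb] := sz b bs.
    have bar : cmod (b - a) <= r by apply: (le_trans ba); lra.
    have [D hD] := dg b bar; have [d d0 hd] := hD 1 ltr01.
    have h1 : bounded_near (fun w => g w * (w - b)^-1) b.
      exists (1 + cmod D), d; split=> // z zb /hd.
      have zb0 : 0 < cmod (z - b) by rewrite cmod_gt0 subr_eq0.
      rewrite gb subr0 mul1r cmodM cmodV ler_pdivrMr// => h1.
      have := cmodD (g z - D * (z - b)) (D * (z - b)); rewrite subrK cmodM.
      by move: h1; clear; lra.
    have h2 : bounded_near (fun w => (\prod_(c <- rem b s) (w - c))^-1) b.
      apply: bounded_near_cdiff; apply: cdiffV; last exact: dP.
      by apply: P0; rewrite mem_rem_uniqF.
    have -> : (fun w => g w * (P w)^-1) =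
        (fun w => g w * (w - b)^-1 * (\prod_(c <- rem b s) (w - c))^-1).
      by apply/funext => z; rewrite /P (big_rem b)//= invfM mulrA.
    exact: bounded_nearM.
  - by move=> b /sz[ba _]; apply: (le_lt_trans ba); lra.
  - move=> z za; rewrite cmodM cmodV; apply: ler_pM; rewrite ?cmod_ge0 ?invr_ge0 ?cmod_ge0//.
      by apply: pmax; rewrite za.
    rewrite lef_pV2 ?posrE//; last first.
      rewrite cmod_gt0; apply: P0; apply/negP => /sz[+ _]; rewrite za; move: r0; clear; lra.
    rewrite /P cmod_prod -sk; apply: const_le_prod; first by lra.
    move=> b /sz[ba _]; have := cmod_dist z b a; rewrite za.
    by move: ba; clear; lra.
  - by apply: (le_trans wa); lra.
move=> h1; have h2 : cmod (P w) <= (2 * r / 5) ^+ k.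
  rewrite /P cmod_prod -sk; apply: prod_le_const => b /sz[ba _].
  rewrite cmod_ge0 /=; have := cmod_dist w a b; rewrite (cmodB a b).
  by move: wa ba; clear; lra.
have := ler_pM (cmod_ge0 _) (cmod_ge0 _) h1 h2.
rewrite -cmodM divfK; last exact: P0.
have -> : M / (4 * r / 5) ^+ k * (2 * r / 5) ^+ k = M / 2 ^+ k.
  have -> : (4 * r / 5) ^+ k = 2 ^+ k * (2 * r / 5) ^+ k.
    by rewrite -exprMn; congr (_ ^+ k); field.
  by field; rewrite !expf_neq0//= gt_eqF//; lra.
by move=> /(lt_le_trans hk); rewrite ltxx.
Qed.

(** Otherwise every disc around [a] contains arbitrarily many points with value [g a]. *)
Lemma locally_constant_or_isolated g a : (\forall w \near a, cdiff g w) ->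
  (\forall w \near a, g w = g a) \/ (\forall w \near a^', g w <> g a).
Proof.
move=> /nbhs_cplxP[r1 r10 dg].
have [|nisol] := pselect (\forall w \near a^', g w <> g a); [by right|left].
pose r := r1 / 2; have r0 : 0 < r by rewrite /r; lra.
have acc d : 0 < d -> exists2 w, 0 < cmod (w - a) < d & g w = g a.
  move=> d0; apply: contrapT => H; apply: nisol.
  rewrite /dnbhs near_withinE; apply/nbhs_cplxP; exists d => // w wd wa gw.
  by apply: H; exists w => //; rewrite wd cmod_gt0 subr_eq0 wa.
suff H : forall w, cmod (w - a) <= r / 5 -> g w - g a = 0.
  apply/nbhs_cplxP; exists (r / 5); first by lra.
  by move=> w /ltW/H/eqP; rewrite subr_eq0 => /eqP.
apply: (many_zeros r0).
  move=> w wa; apply: cdiffD; last exact: cdiff_cst.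
  by apply: dg; apply: (le_lt_trans wa); rewrite /r; lra.
move=> k.
suff [s [d [d0 sk us sz]]] : exists s d, [/\ 0 < d, size s = k, uniq s &
    forall b, b \in s -> d <= cmod (b - a) <= r / 5 /\ g b = g a].
  by exists s; split=> // b /sz[/andP[_ ?] ->]; rewrite subrr.
elim: k => [|k [s [d [d0 sk us sz]]]]; first by exists [::], 1; split.
have [|w /andP[w0 wd] gw] := acc (Num.min d (r / 5)).
  by rewrite lt_min d0 /=; lra.
move: wd; rewrite lt_min => /andP[wd wr].
exists (w :: s), (cmod (w - a)); split=> //=; first by rewrite sk.
- rewrite us andbT; apply/negP => /sz[/andP[+ _] _].
  by rewrite leNgt wd.
- move=> b; rewrite in_cons => /orP[/eqP ->|/sz[/andP[h1 h2] ->]].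
    by rewrite lexx ltW.
  by rewrite h2 andbT; split=> //; apply: le_trans h1; exact: ltW.
Qed.

(** If [v] is close to [g a] and not a value of [g] on the disc, then
    [1 / (g - v)] is larger at [a] than on the circle. *)
Lemma open_mapping g a r : 0 < r -> (forall w, cmod (w - a) <= r -> cdiff g w) ->
  (forall w, w <> a -> cmod (w - a) <= r -> g w <> g a) ->
  \forall v \near g a, exists2 w, cmod (w - a) <= r & g w = v.
Proof.
move=> r0 dg gne.
have Gc z : cmod (z - a) <= r -> {for z, continuous (fun w => cmod (g w - g a))}.
  move=> za; have dz := cdiff_continuous (dg z za).
  exact: (@continuous_comp _ _ _ g (fun w => cmod (w - g a)) z dz (@dist_continuous R (g a) (g z))).
pose S : set (Cplx R) := [set w | cmod (w - a) = r].
have [m m0 hm] : exists2 m, 0 < m & forall w, cmod (w - a) = r -> m <= cmod (g w - g a).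
  have cS : compact S.
    apply: (@subclosed_compact _ _ (disc a r)); last by move=> w; rewrite /S /disc /mkset => ->.
    - apply: (@closed_comp _ R^o (fun w => cmod (w - a)) [set r]).
        by move=> w _; exact: dist_continuous.
      exact: closed_eq.
    - exact: disc_compact.
  have [||p] := @compact_EVT_min _ R (fun w => cmod (g w - g a)) S _ cS.
  - exists (a + r%:C%C).
    by rewrite /S /= addrAC subrr add0r cmodR gtr0_norm.
  - by apply: continuous_in_subspaceT => w; rewrite inE => wS; apply: Gc; rewrite wS.
  rewrite inE => pS pmin; exists (cmod (g p - g a)); last by move=> w wS; apply: pmin; rewrite inE.
  rewrite cmod_gt0 subr_eq0; apply/eqP; apply: gne; last by rewrite pS.
  by move=> pa; move: r0; rewrite -pS pa subrr cmod0 ltxx.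
apply/nbhs_cplxP; exists (m / 2); first by lra.
move=> v va; apply: contrapT => nv.
have gv w : cmod (w - a) <= r -> g w - v != 0.
  by move=> wa; rewrite subr_eq0; apply/eqP => gw; apply: nv; exists w.
have := @cmod_disc_le (fun w => (g w - v)^-1) a r (m / 2)^-1 r0.
have aa : cmod (a - a) <= r by rewrite subrr cmod0 ltW.
move=> H; have : cmod (g a - v)^-1 <= (m / 2)^-1.
  apply: H aa => w wa.
    apply: cdiffV; first exact: gv.
    by apply: cdiffD; [exact: dg|exact: cdiff_cst].
  rewrite cmodV lef_pV2 ?posrE//; last 2 first.
  - by rewrite cmod_gt0; apply: gv; rewrite wa.
  - by lra.
  have := cmod_dist (g w) v (g a); have := hm w wa; move: va; clear; lra.
rewrite cmodV lef_pV2 ?posrE//; last 2 first.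
- by rewrite cmod_gt0; exact: gv.
- by lra.
by rewrite cmodB leNgt va.
Qed.

End MaximumModulusDisc.

(** * Separating components *)

Section Components.
Variables (R : realType) (X : topologicalType).
Hypotheses (hX : hausdorff_space X) (cX : compact [set: X]).
Implicit Types A B C Q : set X.

Lemma connected_split A Q1 Q2 : connected A -> closed Q1 -> closed Q2 ->
  A `<=` Q1 `|` Q2 -> A `&` Q1 `&` Q2 = set0 -> A `<=` Q1 \/ A `<=` Q2.
Proof.
move=> cA c1 c2 AQ dis.
have [[x [Ax Q1x]]|n1] := pselect (exists x, A x /\ Q1 x); last first.
  by right=> x Ax; case: (AQ x Ax) => // Q1x; case: n1; exists x.
left; suff : A `&` Q1 = A by move=> <- y [].
apply: cA; first by exists x.
- exists (~` Q2); first exact: closed_openC.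
  apply/seteqP; split=> y [Ay Qy]; split=> //.
    by move=> Q2y; have : set0 y by rewrite -dis.
  by case: (AQ y Ay).
- by exists Q1.
Qed.

(** In a compact Hausdorff space, points in different components of a closed
    set are separated by a partition of this set into two closed sets.  The
    intersection [Q] of the relatively clopen sets containing [x] is shown to be
    connected, so it is contained in the component of [x]. *)
Lemma connected_component_separation A x y : closed A -> A x -> A y ->
  ~ connected_component A x y ->
  exists B C, [/\ closed B, closed C, B `&` C = set0, A = B `|` C & B x /\ C y].
Proof.
move=> cA Ax Ay nxy.
pose F : set (set X) := [set B | [/\ closed B, closed (A `\` B), B `<=` A & B x]].
have FA : F A by split=> //; rewrite setDv; exact: closed0.
have FI B C : F B -> F C -> F (B `&` C).
  move=> [c1 d1 s1 x1] [c2 d2 s2 x2]; split=> //.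
  - exact: closedI.
  - by rewrite setDIr; exact: closedU.
  - by move=> z [/s1].
suff [B [cB dB BA Bx] nBy] : exists2 B, F B & ~ B y.
  exists B, (A `\` B); split=> //; last by rewrite setDUK.
  by rewrite setDE setICA setICr setI0.
apply: contrapT => nB; apply: nxy.
pose Q := \bigcap_(B in F) B.
have Qx : Q x by move=> B [].
have Qy : Q y by move=> B FB; apply: contrapT => By; apply: nB; exists B.
have QA : Q `<=` A by move=> z; apply.
have cQ : closed Q by apply: closed_bigI => B [].
exists Q => //; split=> //.
apply/connectedP => E [E0 QE [s1 s2]].
have clE b : closed (E b).
  rewrite closure_id; apply/seteqP; split; first exact: subset_closure.
  move=> z Ez; have Qz : Q z.
    rewrite (closure_id Q).1//; apply: closureS Ez => t Et.
    by rewrite QE; case: b Et; [right|left].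
  move: Qz; rewrite QE; case: b Ez => Ez [] // Ez'.
    by have : set0 z by rewrite -s2.
  by have : set0 z by rewrite -s1.
have disE : E false `&` E true = set0 by rewrite -s1 -(closure_id _).1.
have /(@normal_openP R)/(_ _ _ (clE false) (clE true) disE) := compact_normal hX cX.
move=> [U [V [oU oV EU EV UV]]].
(* by compactness, one clopen set already lies in the union of U and V *)
have [B FB BUV] : exists2 B, F B & B `<=` U `|` V.
  pose K := ~` (U `|` V).
  have cK : compact K.
    apply: (subclosed_compact _ cX) => //.
    by apply: open_closedC; exact: openU.
  pose G : set_system (set X) := filter_from F (fun B => [set C | C `<=` B]).
  have GF : Filter G.
    apply: filter_from_filter; first by exists A.
    by move=> B C FB FC; exists (B `&` C); [exact: FI|move=> D DBC; split=> z /DBC[]].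
  have := (iffLR (compact_near_coveringP _) cK) _ G (fun B z => ~ B z) GF.
  case.
    move=> z Kz; have [B FB nBz] : exists2 B, F B & ~ B z.
      apply: contrapT => nz; apply: Kz; have : Q z.
        by move=> B FB; apply: contrapT => nBz; apply: nz; exists B.
      by rewrite QE => -[/EU|/EV]; [left|right].
    exists (~` B, [set C | C `<=` B]) => /=.
      split; last by exists B.
      by apply: open_nbhs_nbhs; split=> //; apply: closed_openC; case: FB.
    by move=> [z' C] /= [nz' CB] /CB.
  move=> B FB h; exists B => // z Bz; apply: contrapT => nz.
  exact: (h B (fun _ => id) z nz Bz).
have [cB dB BA Bx] := FB.
have clo W W' : open W -> open W' -> W `&` W' = set0 -> B `<=` W `|` W' -> W x -> F (B `\` W').
  move=> oW oW' WW' BW Wx; split.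
  - by rewrite setDE; apply: closedI => //; exact: open_closedC.
  - have -> : A `\` (B `\` W') = (A `\` B) `|` (B `\` W).
      apply/seteqP; split=> z.
        move=> [Az nz]; have [Bz|] := pselect (B z); last by left.
        right; split=> // Wz; apply: nz; split=> // W'z.
        by have : set0 z by rewrite -WW'.
      move=> [[Az nBz]|[Bz nWz]]; split=> //; [by case|exact: BA|].
      by move=> [_]; case: (BW z Bz).
    by apply: closedU => //; rewrite setDE; apply: closedI => //; exact: open_closedC.
  - by move=> z [/BA].
  - split=> // W'x; by have : set0 x by rewrite -WW'.
move: Qx; rewrite QE => -[/EU Ux|/EV Vx].
- have [z Ez] := E0 true; have Qz : Q z by rewrite QE; right.
  by have [] := Qz _ (clo U V oU oV UV BUV Ux); move: (EV _ Ez).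
- have [z Ez] := E0 false; have Qz : Q z by rewrite QE; left.
  by rewrite setIC in UV; rewrite setUC in BUV; have [] := Qz _ (clo V U oV oU UV BUV Vx); move: (EU _ Ez).
Qed.

End Components.

(** * The sphere *)

Section SphereTopology.
Variable R : realType.
Implicit Types (z w : Cplx R) (x y : sphere R).

Lemma sphere_compact : compact [set: sphere R].
Proof. exact: one_point_compactification_compact. Qed.

Lemma sphere_hausdorff : hausdorff_space (sphere R).
Proof.
apply: one_point_compactification_hausdorff; last exact: cplx_hausdorff.
exact: cplx_locally_compact.
Qed.

Lemma of_cplx_continuous : continuous (@of_cplx R).
Proof. exact: one_point_compactification_some_continuous. Qed.

Lemma near_sphere_neq x y : x <> y -> \forall x' \near x, x' <> y.
Proof.
move=> xy; apply: open_nbhs_nbhs; split=> //.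
apply: (@closed_openC _ [set y]); apply: compact_closed; [exact: sphere_hausdorff|exact: compact_set1].
Qed.

Lemma chordal_refl x : chordal x x = 0.
Proof. by case: x => [z|]//=; rewrite subrr cmod0 mulr0 mul0r. Qed.

(** Star-shaped sets are connected. *)
Lemma star_connected (A : set (Cplx R)) z : A z ->
  (forall w (t : R), A w -> 0 <= t <= 1 -> A (z + (w - z) * t%:C%C)) -> connected A.
Proof.
move=> Az sA.
pose seg w : set (Cplx R) := (fun t : R => z + (w - z) * t%:C%C) @` `[0, 1]%classic.
have -> : A = \bigcup_(w in A) seg w.
  apply/seteqP; split=> [w Aw|w [w' Aw' [t /=]]].
    exists w => //; exists 1; first by rewrite /= in_itv /= ler01 lexx.
    by rewrite rmorph1 mulr1 addrC subrK.
  by rewrite in_itv /= => t01 <-; exact: sA.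
apply: bigcup_connected.
  exists z => w _; exists 0; first by rewrite /= in_itv /= lexx ler01.
  by rewrite rmorph0 mulr0 addr0.
move=> w _; apply: connected_continuous_connected; first exact: segment_connected.
apply: continuous_subspaceT => t.
have h : ((t'%:C%C : Cplx R) @[t' --> t] --> (t%:C%C : Cplx R)).
  apply/cvg_cplxP => e e0; apply/nbhs_ballP; exists e; first exact: e0.
  by move=> t' tt'; rewrite /mkset -rmorphB cmodR distrC; exact: tt'.
exact: (@affine_cvg R _ _ (nbhs_filter t) _ _ z (w - z) h).
Qed.

Lemma plane_connected : connected [set: Cplx R].
Proof. by apply: (@star_connected _ 0). Qed.

Lemma disc_connected z (r : R) : connected (disc z r).
Proof.
have [r0|r0] := leP 0 r; last first.
  have -> : disc z r = set0; last exact: connected0.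
  apply/seteqP; split=> // w; rewrite /disc /mkset => wr.
  by have := le_lt_trans (cmod_ge0 (w - z)) (le_lt_trans wr r0); rewrite ltxx.
apply: (@star_connected _ z); first by rewrite /disc /mkset subrr cmod0.
move=> w t; rewrite /disc /mkset => wr /andP[t0 t1].
rewrite addrAC subrr add0r cmodM cmodR ger0_norm//.
by apply: le_trans wr; rewrite ler_piMr// cmod_ge0.
Qed.

Lemma sphere_disc_connected z (r : R) : connected (@of_cplx R @` disc z r).
Proof.
apply: connected_continuous_connected; first exact: disc_connected.
by apply: continuous_subspaceT => w; exact: of_cplx_continuous.
Qed.

End SphereTopology.

(** * Iterates, Fatou set and Julia set *)

Lemma near_dnbhsP (R : realType) (z : Cplx R) (P : set (Cplx R)) :
  (\forall w \near z^', P w) <-> (\forall w \near z, w <> z -> P w).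
Proof.
rewrite /dnbhs near_withinE.
by split; apply: filterS => w h wz; apply: h; apply/eqP.
Qed.

Section Iterates.
Variables (R : realType) (f : Cplx R -> sphere R).
Hypothesis mf : meromorphic f.
Implicit Types (z w : Cplx R) (x y : sphere R).

(** The finite values of [f], with value 0 at the poles. *)
Definition fc z : Cplx R := to_cplx (f z).

Lemma fcE z : f z <> infty -> f z = of_cplx (fc z).
Proof. by rewrite /fc; case: (f z). Qed.

Lemma near_finite z : f z <> infty -> \forall w \near z, f w <> infty /\ cdiff fc w.
Proof.
move=> /(proj1 (mf z))[h _]; apply: filterS h => w fw; split=> //.
by apply/cdiffP; have [_] := proj1 (mf w) fw.
Qed.

Lemma meromorphic_continuous : continuous f.
Proof.
move=> z; have [fz|fz] := pselect (f z = infty).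
  have [_ h] := proj2 (mf z) fz.
  move=> U; rewrite fz => Uz; have := h U Uz.
  rewrite /dnbhs /= !nbhs_simpl /within /=; apply: filterS => w hw.
  have [->|wz] := eqVneq w z; last exact: hw.
  by rewrite /= fz; exact: nbhs_singleton Uz.
have /nbhs_singleton[_ dz] := near_finite fz.
move=> U; rewrite {1}(fcE fz) => Uz; have := cdiff_continuous dz Uz.
move=> hU; apply: filterS2 (hU : \near z, U (of_cplx (fc z))) (near_finite fz) => w Uw [fw _].
by rewrite /= (fcE fw).
Qed.

Lemma iterate_infty n : iterate f n.+1 infty = None.
Proof. by elim: n => [//|n IH]; rewrite [LHS]/= -/(iterate f n.+1 infty) IH. Qed.

Lemma iterateS n z : iterate f n.+1 (of_cplx z) = iterate f n (f z).
Proof. by elim: n => [//|n IH]; rewrite [LHS]/= -/(iterate f n.+1 (of_cplx z)) IH. Qed.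

Lemma iterate_totalS n z : iterate_total f n.+1 (of_cplx z) = iterate_total f n (f z).
Proof. by rewrite /iterate_total iterateS. Qed.

Lemma iterate_SomeS n x y : iterate f n.+1 x = Some y ->
  exists2 q, iterate f n x = Some (of_cplx q) & f q = y.
Proof.
rewrite /=; case: (iterate f n x) => [[q|]|]// [<-]; by exists q.
Qed.

(** Where [f ^ n] is defined, it is defined nearby and continuous, as a map to
    the sphere. *)
Lemma iterate_near n x y : iterate f n x = Some y ->
  (\forall x' \near x, iterate f n x' <> None) /\ {for x, continuous (iterate_total f n)}.
Proof.
elim: n y => [|n IH] y.
  by move=> _; split; [exact: filterE|move=> U; exact].
move=> /iterate_SomeS[q nq fq]; have [h1 h2] := IH _ nq.
have itq : iterate_total f n x = of_cplx q by rewrite /iterate_total nq.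
have fin : \forall x' \near x, exists2 q', iterate f n x' = Some (of_cplx q') &
    iterate_total f n.+1 x' = f q'.
  have nq0 : of_cplx q <> infty by [].
  have := h2 _; rewrite itq => /(_ _ (near_sphere_neq nq0)) h3.
  apply: filterS2 h1 h3 => x'.
  rewrite /= /iterate_total /=.
  by case: (iterate f n x') => [[q'|]|]//= _ _; exists q'.
split.
  by apply: filterS fin => x' [q' nq' _] /=; rewrite nq'.
move=> U; have -> : iterate_total f n.+1 x = f q by rewrite /iterate_total /= nq.
move=> /meromorphic_continuous Uq.
have := h2 _; rewrite itq => /(_ (@of_cplx R @` (f @^-1` U))) h3.
have := h3 (@one_point_compactification_some_nbhs _ q _ Uq) => {}h3.
rewrite !nbhs_simpl /=; apply: filterS2 fin h3 => x' [q' nq' itq'] /= [q'' Uq''].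
have -> : iterate_total f n x' = of_cplx q' by rewrite /iterate_total nq'.
by move=> [qq]; rewrite itq' -qq.
Qed.

Lemma iterate_Some_total n x : iterate f n x <> None -> iterate f n x = Some (iterate_total f n x).
Proof. by rewrite /iterate_total; case: (iterate f n x). Qed.

Lemma Fatou_open : open (Fatou f).
Proof.
rewrite openE => x [U [[oU Ux] h1 h2]].
apply: filterS (open_nbhs_nbhs (conj oU Ux)) => y Uy; exists U; split=> //.
Qed.

Lemma Fatou_defined n x : Fatou f x -> iterate f n x <> None.
Proof. by move=> [U [[_ Ux] h _]]; exact: h. Qed.

Lemma Fatou_infty : ~ Fatou f infty.
Proof. by move=> /(@Fatou_defined 1). Qed.

Lemma subsequence_ex (P : nat -> Prop) : (forall N, exists2 k, (N <= k)%N & P k) ->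
  exists phi : nat -> nat, {homo phi : m n / (m < n)%N} /\ forall k, P (phi k).
Proof.
move=> H; have {}H N : {k | (N <= k)%N /\ P k}.
  by apply: cid; have [k Nk Pk] := H N; exists k.
pose fix phi n := if n is m.+1 then projT1 (H (phi m).+1) else projT1 (H 0%N).
exists phi; split.
  apply: homo_ltn; first exact: ltn_trans.
  by move=> k /=; case: (H _) => ? [].
by case=> [|k] /=; case: (H _) => ? [].
Qed.

(** A sequence of iterates is, after extraction, either constantly the identity
    or eventually of the form [f ^ (n + 1)]; in the latter case it is a sequence
    of iterates precomposed with [f]. *)
Lemma Fatou_preimage z : Fatou f (f z) -> Fatou f (of_cplx z).
Proof.
move=> [U [[oU Ufz] Udef Unorm]].
exists (@of_cplx R @` (f @^-1` U)); split.
- split; last by exists z.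
  apply: one_point_compactification_open_some.
  by apply: open_comp => // w _; exact: meromorphic_continuous.
- by move=> [|n] _ [w Uw <-]//; rewrite iterateS; exact: Udef.
move=> g gr; have {}gr k : exists n, iterate_total f n = g k.
  by have [n _ <-] := gr k; exists n.
have [n gn] := choice gr.
have [inf0|] := pselect (forall N, exists2 k, (N <= k)%N & n k = 0%N).
  have [phi [hphi n0]] := subsequence_ex inf0.
  exists phi, id; split=> // x _; exists setT; first exact: filterT.
  move=> e e0; apply: nearW => k y _ _ /=.
  by rewrite -gn n0 /iterate_total /= chordal_refl.
move=> /existsNP[N hN].
have npos k : (N <= k)%N -> n k = (n k).-1.+1.
  by move=> Nk; rewrite prednK// lt0n; apply/eqP => nk; apply: hN; exists k.
have [k|phi [h [hphi huni]]] := Unorm (fun k => iterate_total f (n k).-1).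
  by exists (n k).-1.
exists phi, (fun x => if x is Some w then h (f w) else infty); split=> // _ [w Uw <-].
have [V Vfw hV] := huni _ Uw.
exists (@of_cplx R @` (f @^-1` V)).
  by apply: one_point_compactification_some_nbhs; exact: meromorphic_continuous.
move=> e e0; have [N' _ hN'] := hV e e0.
exists (maxn N N'); first by [].
move=> k; rewrite /mkset geq_max => /andP[Nk N'k].
move=> _ [w' Vw' <-] [w'' Uw'' [ww]]; rewrite {}ww in Uw'' => {w''}.
have phik i : (i <= phi i)%N.
  by elim: i => // i IH; apply: (leq_ltn_trans IH); exact: hphi.
rewrite /= -gn npos; last exact: leq_trans (phik k).
by rewrite iterate_totalS; exact: hN'.
Qed.

Lemma Julia_iterate n x y : Julia f x -> iterate f n x = Some y -> Julia f y.
Proof.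
move=> Jx; elim: n y => [|n IH] y; first by move=> [<-].
move=> /iterate_SomeS[q /IH Jq <-] Ffq; apply: Jq; exact: Fatou_preimage.
Qed.


(* [f] is not constant near any point. *)
Hypothesis ncf : forall z, f z <> infty -> ~ (\forall w \near z, f w = f z).

(** The points where [f] takes a given value are isolated, poles included. *)
Lemma meromorphic_isolated z : \forall w \near z^', f w <> f z.
Proof.
have [fz|fz] := pselect (f z = infty).
  by have [h _] := proj2 (mf z) fz; rewrite fz.
have nz := near_finite fz.
have dz : \forall w \near z, cdiff fc w by apply: filterS nz => w [].
have [lc|iso] := locally_constant_or_isolated dz.
  exfalso; apply: (ncf fz); apply: filterS2 lc nz => w fcw [fw _].
  by rewrite (fcE fw) fcw -fcE.
by apply: filterS iso => w; rewrite /fc => h fw; apply: h; rewrite fw.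
Qed.

Lemma iterate_isolated n z y : iterate f n (of_cplx z) = Some y ->
  \forall w \near z^', iterate f n (of_cplx w) <> Some y.
Proof.
elim: n y => [|n IH] y.
  by move=> [<-]; apply/near_dnbhsP; apply: filterE => w wz /= [].
move=> /iterate_SomeS[q nq fq]; have [_ cn] := iterate_near nq.
have /near_dnbhsP nIH := IH _ nq; have /near_dnbhsP hq := meromorphic_isolated q.
have itq : iterate_total f n (of_cplx z) = of_cplx q by rewrite /iterate_total nq.
have := cn _; rewrite itq => /(_ _ (@one_point_compactification_some_nbhs _ q _ hq)) h3.
have {}h3 := of_cplx_continuous h3.
apply/near_dnbhsP.
apply: filterS2 nIH (h3 : \near z, _) => w hw [q' hq' itq'] wz nw.
have [q'' nq'' fq''] := iterate_SomeS nw.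
have qq : q' = q'' by move: itq'; rewrite /iterate_total nq'' => -[].
apply: (hq' _); last by rewrite qq fq''.
by move=> qq'; apply: (hw wz); rewrite nq'' -qq qq'.
Qed.

(** A closed disc [D] around [z] inside the neighbourhood that witnesses
    [z] being in the Fatou set has an image containing an open neighbourhood of
    [f z].  There the limit function is defined by choosing preimages in [D],
    and local uniform convergence is uniform on the compact set [D]. *)
Lemma Fatou_image z : Fatou f (of_cplx z) -> Fatou f (f z).
Proof.
move=> Fz; have fz : f z <> infty.
  by move=> fz; have := @Fatou_defined 2 _ Fz; rewrite /= fz.
have [U [[oU Uz] Udef Unorm]] := Fz.
have : \forall w \near z, [/\ U (of_cplx w), f w <> infty & cdiff fc w].
  have hU : \forall w \near z, U (of_cplx w).
    by apply: of_cplx_continuous; exact: open_nbhs_nbhs.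
  by apply: filterS2 hU (near_finite fz) => w ? [].
move=> /nbhs_cplxP[r1 r10 h1].
have /near_dnbhsP/nbhs_cplxP[r2 r20 h2] := meromorphic_isolated z.
pose r := Num.min r1 r2 / 2.
have m0 : 0 < Num.min r1 r2 by rewrite lt_min r10.
have r0 : 0 < r by rewrite /r; lra.
have rm : r < Num.min r1 r2 by rewrite /r; lra.
have {}h1 w : cmod (w - z) <= r -> [/\ U (of_cplx w), f w <> infty & cdiff fc w].
  by move=> wz; apply: h1; apply: (le_lt_trans wz); apply: (lt_le_trans rm); rewrite ge_min lexx.
have {}h2 w : w <> z -> cmod (w - z) <= r -> fc w <> fc z.
  move=> wz wr fcw; have [_ fw _] := h1 w wr.
  apply: (h2 w); [|exact: wz|by rewrite (fcE fw) fcw -fcE].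
  by apply: (le_lt_trans wr); apply: (lt_le_trans rm); rewrite ge_min lexx orbT.
have h1d w : cmod (w - z) <= r -> cdiff fc w by case/h1.
have : nbhs (fc z) (fun v => exists2 w, cmod (w - z) <= r & fc w = v) := open_mapping r0 h1d h2.
rewrite nbhsE => -[D [oD Dz] DV].
have DVf v : D v -> exists2 w, cmod (w - z) <= r & f w = of_cplx v.
  by move=> /DV[w wr <-]; exists w => //; have [_ fw _] := h1 w wr; exact: fcE.
exists (@of_cplx R @` D); split.
- split; first exact: one_point_compactification_open_some.
  by exists (fc z) => //; rewrite -fcE.
- move=> n _ [v /DVf[w wr <-] <-]; rewrite -iterateS; apply: Udef.
  by case: (h1 w wr).
move=> g gr; have {}gr k : exists n, iterate_total f n = g k.
  by have [n _ <-] := gr k; exists n.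
have [n gn] := choice gr.
have [k|phi [h [hphi huni]]] := Unorm (fun k => iterate_total f (n k).+1).
  by exists (n k).+1.
have pre y : exists w, (exists2 v, D v & of_cplx v = y) -> cmod (w - z) <= r /\ f w = y.
  have [[v /DVf[w wr fw] vy]|no] := pselect (exists2 v, D v & of_cplx v = y).
    by exists w => _; rewrite -vy.
  by exists z.
have [p hp] := choice pre.
exists phi, (fun y => h (of_cplx (p y))); split=> // y _.
exists setT; first exact: filterT.
move=> e e0.
have cd := iffLR (compact_near_coveringP _) (@disc_compact R z r).
have := cd nat \oo (fun k w => U (of_cplx w) ->
  chordal (iterate_total f (n (phi k)).+1 (of_cplx w)) (h (of_cplx w)) < e) _.
case.
  move=> w wr; have [Uw _ _] := h1 w wr.
  have [V Vw hV] := huni _ Uw.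
  exists (@of_cplx R @^-1` V, [set k | forall y, V y -> U y ->
     chordal (iterate_total f (n (phi k)).+1 y) (h y) < e]) => /=.
    split; first exact: of_cplx_continuous.
    exact: (hV e e0).
  by move=> [w' k] /= [Vw' hk] Uw'; exact: hk.
move=> N _ hN; exists N; first by [].
move=> k Nk y' _ Dy'; have [pr fp] := hp y' Dy'.
rewrite /= -gn -{1}fp -iterate_totalS.
by apply: (hN k Nk) => //; have [] := h1 _ pr.
Qed.

Lemma Fatou_iterate n x y : Fatou f x -> iterate f n x = Some y -> Fatou f y.
Proof.
move=> Fx; elim: n y => [|n IH] y; first by move=> [<-].
by move=> /iterate_SomeS[q /IH Fq <-]; exact: Fatou_image.
Qed.

End Iterates.

(** * Components of the Julia set *)

Section Buried.
Variables (R : realType) (f : Cplx R -> sphere R).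
Hypothesis mf : meromorphic f.
Implicit Types (z w : Cplx R) (x y : sphere R).

(** The points near which [f] is constantly equal to [f z] form an open and
    closed subset of the plane, which does not contain the pole [p]. *)
Lemma not_locally_constant p z : f p = infty -> f z <> infty ->
  ~ (\forall w \near z, f w = f z).
Proof.
move=> fp fz lc.
pose S : set (Cplx R) := [set w | \forall w' \near w, f w' = f z].
have oS : open S.
  rewrite openE => w /nbhs_cplxP[r r0 h]; apply/nbhs_cplxP; exists (r / 2); first by lra.
  move=> w' ww'; apply/nbhs_cplxP; exists (r / 2); first by lra.
  by move=> w'' ww''; apply: h; have := cmod_dist w'' w' w; lra.
have cS : closed S.
  move=> w clw.
  have acc (P : set (Cplx R)) : (\forall w' \near w, P w') -> exists2 w', P w' & S w'.
    by move=> /clw[w' [Sw' Pw']]; exists w'.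
  have fw : f w = f z.
    apply: contrapT => /near_sphere_neq/(meromorphic_continuous mf)/acc[w' /= nfw' Sw'].
    by apply: nfw'; exact: nbhs_singleton Sw'.
  have nfw : f w <> infty by rewrite fw.
  have nw := near_finite mf nfw.
  have dw : \forall w' \near w, cdiff (fc f) w' by apply: filterS nw => w' [].
  have [lcw|/near_dnbhsP iso] := locally_constant_or_isolated dw.
    by apply: filterS2 lcw nw => w' h [nf _]; rewrite (fcE nf) h -fcE.
  have [w' hw' Sw'] := acc _ iso.
  have [<-//|ww'] := pselect (w' = w).
  case: (hw' ww'); rewrite /fc fw; congr to_cplx; exact: nbhs_singleton Sw'.
have : S p.
  have -> // : S = [set: Cplx R].
  apply: (@plane_connected R); first by exists z.
  - by exists S; rewrite ?setTI.
  - by exists S; rewrite ?setTI.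
by move=> /nbhs_singleton; rewrite fp => /esym.
Qed.

Hypothesis ncf : forall z, f z <> infty -> ~ (\forall w \near z, f w = f z).

(** Let [f ^ m (z)] be infinite.  A connected set [X] that accumulates at [z]
    and on which [f ^ m] stays in the union of two disjoint closed sets [B] and
    [C], where [C] contains infinity and [B] a large disc, does not leave a
    small disc around [z]: on the boundary circle [f ^ m] takes values in [B].
    How large the disc in [B] has to be depends on [m], [z] and the point [y0]
    to be excluded from [X]. *)
Lemma connected_near_pole m z y0 : iterate f m (of_cplx z) = Some infty ->
  y0 <> of_cplx z -> exists r : R, forall (B C X : set (sphere R)),
    closed B -> closed C -> B `&` C = set0 ->
    (forall w, cmod w <= r -> B (of_cplx w)) -> C infty ->
    connected X -> (forall x y, X x -> iterate f m x = Some y -> (B `|` C) y) ->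
    closure X (of_cplx z) -> ~ X y0.
Proof.
move=> zm y0z; have [defz _] := iterate_near mf zm.
have /near_dnbhsP iso := iterate_isolated mf ncf zm.
have {}defz : \forall w \near z, iterate f m (of_cplx w) <> None.
  exact: (@of_cplx_continuous R z _ defz).
have ny0 : \forall w \near z, of_cplx w <> y0.
  exact: (@of_cplx_continuous R z _ (near_sphere_neq (not_eq_sym y0z))).
have /nbhs_cplxP[r1 r10 h1] : \forall w \near z, [/\ iterate f m (of_cplx w) <> None,
    of_cplx w <> y0 & w <> z -> iterate f m (of_cplx w) <> Some infty].
  by apply: filterS3 defz ny0 iso => w.
pose rho := r1 / 2; have rho0 : 0 < rho by rewrite /rho; lra.
have dsc w : cmod (w - z) <= rho -> [/\ iterate f m (of_cplx w) <> None, of_cplx w <> y0 &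
    w <> z -> iterate f m (of_cplx w) <> Some infty].
  move=> wz; apply: h1; apply: (le_lt_trans wz); rewrite /rho; lra.
pose T w := iterate_total f m (of_cplx w).
have itT w : cmod (w - z) <= rho -> iterate f m (of_cplx w) = Some (T w).
  by move=> /dsc[d _ _]; exact: iterate_Some_total.
have cT w : cmod (w - z) <= rho -> {for w, continuous T}.
  move=> wz; have [_ c] := iterate_near mf (itT w wz).
  exact: (@continuous_comp _ _ _ (@of_cplx R) (iterate_total f m) w (@of_cplx_continuous R w) c).
have Tfin w : cmod (w - z) = rho -> T w <> infty.
  move=> wz Tw; have [|_ _] := dsc w; first by rewrite wz.
  apply; last by rewrite itT ?wz// Tw.
  by move=> wz'; move: rho0; rewrite -wz wz' subrr cmod0 ltxx.
have [r hr] : exists r : R, forall w, cmod (w - z) = rho -> exists2 v, cmod v <= r & T w = of_cplx v.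
  pose Sc : set (Cplx R) := [set w | cmod (w - z) = rho].
  have cSc : compact Sc.
    apply: (@subclosed_compact _ _ (disc z rho)).
    - apply: (@closed_comp _ R^o (fun w => cmod (w - z)) [set rho]).
        by move=> w _; exact: dist_continuous.
      exact: closed_eq.
    - exact: disc_compact.
    - by move=> w; rewrite /Sc /disc /mkset => ->.
  have := iffLR (compact_near_coveringP _) cSc nat \oo
    (fun k w => exists2 v, cmod v <= k%:R & T w = of_cplx v) _.
  case.
    move=> w wz; have Tw := Tfin w wz.
    have [v Twv] : exists v, T w = of_cplx v.
      by move: Tw; case: (T w) => [v|//] _; exists v.
    have wz' : cmod (w - z) <= rho by rewrite wz.
    have nv : \forall w' \near w, exists2 v', cmod (v' - v) < 1 & T w' = of_cplx v'.
      have hU : nbhs (T w) (@of_cplx R @` [set v' | cmod (v' - v) < 1]).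
        by rewrite Twv; apply: one_point_compactification_some_nbhs; exact: near_cplx.
      have h3 : \forall w' \near w, (@of_cplx R @` [set v' | cmod (v' - v) < 1]) (T w') := cT w wz' _ hU.
      by apply: filterS h3 => w' [v' hv' <-]; exists v'.
    pose k0 := Num.bound (cmod v + 1).
    have hk0 : cmod v + 1 < k0%:R by apply: archi_boundP; rewrite addr_ge0 ?cmod_ge0.
    exists ([set w' | exists2 v', cmod (v' - v) < 1 & T w' = of_cplx v'], [set k | (k0 <= k)%N]) => /=.
      by split=> //; exists k0.
    move=> [w' k] /= [[v' hv' Tv'] k0k]; exists v' => //.
    have : (k0%:R : R) <= k%:R by rewrite ler_nat.
    by have := cmodD (v' - v) v; rewrite subrK; move: hv' hk0; clear; lra.
  by move=> N _ hN; exists N%:R => w wz; apply: (hN N) => //=.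
exists r => B C X clB clC BC rB Cinf cX XBC clX Xy0.
have noBC y : B y -> ~ C y by move=> By Cy; have : set0 y by rewrite -BC.
(* S is closed, V is open, and both have the same intersection with X *)
pose S : set (sphere R) := @of_cplx R @` (disc z rho `&` T @^-1` C).
pose V : set (sphere R) := @of_cplx R @` [set w | cmod (w - z) < rho /\ ~ B (T w)].
have near_avoid D w : closed D -> cmod (w - z) <= rho -> ~ D (T w) -> \forall w' \near w, ~ D (T w').
  by move=> cD wz nD; exact: (cT w wz (~` D) (open_nbhs_nbhs (conj (closed_openC cD) nD))).
have clS : closed S.
  apply: compact_closed; first exact: sphere_hausdorff.
  apply: continuous_compact.
    by apply: continuous_subspaceT => w; exact: of_cplx_continuous.
  apply: (@subclosed_compact _ _ (disc z rho)); [|exact: disc_compact|by move=> w []].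
  move=> w clw; have wz : disc z rho w.
    rewrite (closure_id (disc z rho)).1; last exact: disc_closed.
    by apply: closureS clw => ? [].
  split=> //; rewrite /preimage /mkset; apply: contrapT => nC.
  have /clw[w' [[_ Cw'] nCw']] : \forall w' \near w, ~ C (T w').
    exact: near_avoid.
  exact: nCw'.
have oV : open V.
  apply: one_point_compactification_open_some.
  rewrite openE => w [wz nB].
  have h : \forall w' \near w, cmod (w' - z) < rho.
    apply/nbhs_cplxP; exists (rho - cmod (w - z)); first by rewrite subr_gt0.
    by move=> w' ww'; have := cmod_dist w' w z; lra.
  have h' : \forall w' \near w, ~ B (T w').
    by apply: near_avoid => //; exact: ltW.
  exact: filterS2 h h'.
have XSV : X `&` S = X `&` V.
  apply/seteqP; split=> x [Xx [w [wz hw] wx]]; split=> //.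
  - exists w => //; split; last by move=> /noBC; exact.
    rewrite lt_neqAle; apply/andP; split=> //; apply/eqP => wr.
    by have [v vr Tv] := hr w wr; apply: (noBC (T w)) => //; rewrite Tv; exact: rB.
  - have wz' := ltW wz; exists w => //; split=> //.
    have : (B `|` C) (T w) by apply: (XBC x) => //; rewrite -wx; exact: itT.
    by case.
have Vz : V (of_cplx z).
  exists z => //; rewrite /mkset subrr cmod0; split=> //.
  by rewrite /T /iterate_total zm /= => /noBC.
have : X `&` S = X.
  apply: cX.
  - have [x [Xx Vx]] := clX _ (open_nbhs_nbhs (conj oV Vz)).
    by rewrite XSV; exists x.
  - by exists V.
  - by exists S.
move=> XS; move: Xy0; rewrite -XS => -[_ [w [wz _] wy]].
by have [_ + _] := dsc w wz; exact.
Qed.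

Lemma Fatou_component_open W : Fatou_component f W -> open W.
Proof.
move=> [x Fx ->]; rewrite openE => y cy.
have Fy := connected_component_sub cy.
have := @Fatou_open R f; rewrite openE => /(_ y Fy).
case: y cy Fy => [w|] cy Fy; last by case: (Fatou_infty Fy).
move=> h; have := @of_cplx_continuous R w _ h => /nbhs_cplxP[r r0 hr].
have hd : @of_cplx R @` disc w (r / 2) `<=` connected_component (Fatou f) (of_cplx w).
  apply: connected_component_max; [|..|exact: sphere_disc_connected].
    by exists w => //; rewrite /disc /mkset subrr cmod0; lra.
  move=> _ [w' ww' <-]; apply: hr; apply: (le_lt_trans ww'); lra.
rewrite (same_connected_component cy).
apply: filterS hd _; apply: one_point_compactification_some_nbhs.
by apply/nbhs_cplxP; exists (r / 2); [lra|move=> w' /ltW].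
Qed.

(** The complements of the Fatou components [Wn n] can be cut arbitrarily close
    to infinity. *)
Lemma Baker_separation W Wn : component_orbit f W Wn ->
  (\forall n \near \oo, [/\ multiply_connected (Wn n),
        bounded_in_cplx (Wn n) & surrounds (Wn n) [set of_cplx 0]]) ->
  dist0 (Wn n) @[n --> \oo] --> +oo ->
  forall (r : R) N, exists2 n, (N <= n)%N & exists B C : set (sphere R),
  [/\ closed B, closed C, B `&` C = set0, ~` Wn n = B `|` C &
     (forall w, cmod w <= r -> B (of_cplx w)) /\ C infty].
Proof.
move=> [_ orb] ev dst r N.
pose r1 := Num.max r 0.
have dr : \forall n \near \oo, r1 < dist0 (Wn n).
  exact: (cvgry_gt dst r1).
have [N' _ hN'] := filterI ev dr.
pose n := maxn N N'.
exists n; first exact: leq_maxl.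
have [[_ _ [K [Kc [Kinf _] K0]]] rd] := hN' n (leq_maxr _ _).
have [Fn _] := orb n.
have nWinf : ~ Wn n infty by case: Fn => x _ -> /connected_component_sub/Fatou_infty.
have dW : @of_cplx R @` disc 0 r1 `<=` ~` Wn n.
  move=> _ [w wr <-] Ww; move: rd; rewrite ltNge => /negP; apply.
  move: wr; rewrite /disc /mkset subr0; apply: le_trans.
  apply: ge_inf; last by exists w.
  by exists 0 => _ [v _ <-]; exact: cmod_ge0.
have r10 : 0 <= r1 by rewrite le_max lexx orbT.
have d0 : (@of_cplx R @` disc 0 r1) (of_cplx 0).
  by exists 0 => //; rewrite /disc /mkset subrr cmod0.
have nc : ~ connected_component (~` Wn n) (of_cplx 0) infty.
  move=> h; apply: Kinf; case: Kc K0 => x _ -> /(_ (of_cplx 0) erefl) cx.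
  by rewrite (same_connected_component cx).
have clW : closed (~` Wn n) by apply: open_closedC; exact: Fatou_component_open.
have [B [C [cB cC BC WBC [B0 Cinf]]]] := connected_component_separation R
  (@sphere_hausdorff R) (@sphere_compact R) clW (dW _ d0) nWinf nc.
exists B, C; split=> //; split=> // w wr.
have noBC y : B y -> ~ C y by move=> By Cy; have : set0 y by rewrite -BC.
have Dw : (@of_cplx R @` disc 0 r1) (of_cplx w).
  by exists w => //; rewrite /disc /mkset subr0 le_max wr.
have [||h|h] := connected_split (@sphere_disc_connected R 0 r1) cB cC.
- by rewrite -WBC.
- by rewrite -setIA BC setI0.
- exact: h.
- by case: (noBC _ B0); exact: h.
Qed.

End Buried.

Theorem proposition3p7 (R : realType) (f : Cplx R -> sphere R)
  (hf : transcendental_meromorphic f)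
  (hW : exists W : set (sphere R), Baker_wandering_domain f W)
  (z : sphere R)
  (hz : exists m : nat, (1 <= m)%N /\ iterate f m z = Some infty) :
  Julia_component f [set z] /\ buried f [set z].
Proof.
have [mf _] := hf; have [W [Wn [_ orb dis ev [dst _]]]] := hW.
have [m [m1 zm]] := hz.
case: z hz zm => [z|] hz zm; last by case: m m1 zm => // m _; rewrite iterate_infty.
have [p fp] : exists p, f p = infty.
  by case: m m1 zm => // m _ /iterate_SomeS[q _ fq]; exists q.
have ncf w : f w <> infty -> ~ (\forall w' \near w, f w' = f w).
  exact: not_locally_constant fp.
have sep := Baker_separation orb ev dst.
have Jz : Julia f (of_cplx z) by move=> /(@Fatou_defined _ _ m.+1); apply; rewrite /= zm.
split.
- exists (of_cplx z) => //; apply/seteqP; split.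
    by move=> _ ->; exact: connected_component_refl.
  move=> y0 cy0; apply: contrapT => y0z.
  have [r hr] := connected_near_pole mf ncf zm y0z.
  have [n _ [B [C [cB cC BC WBC [rB Cinf]]]]] := sep r 0%N.
  apply: (hr B C _ cB cC BC rB Cinf (@component_connected _ (Julia f) (of_cplx z)) _ _ cy0).
    move=> x y /connected_component_sub Jx xy; rewrite -WBC => Wy.
    apply: (Julia_iterate mf Jx xy).
    by have [[x' _ Wx'] _] := orb.2 n; move: Wy; rewrite Wx' => /connected_component_sub.
  by apply: subset_closure; exact: connected_component_refl.
move=> V FV; apply/seteqP; split=> // _ [-> [clV _]].
have VF : V `<=` Fatou f by case: FV => x _ -> y /connected_component_sub.
have [y0 Vy0] : V !=set0.
  by case: FV => x Fx ->; exists x; exact: connected_component_refl.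
have y0z : y0 <> of_cplx z by move=> y0z; apply: Jz; apply: VF; rewrite -y0z.
have cV : connected V by case: FV => x _ ->; exact: component_connected.
have [r hr] := connected_near_pole mf ncf zm y0z.
(* otherwise V would be trapped near z *)
have meet N : exists2 n, (N <= n)%N & exists x, V x /\ Wn n (iterate_total f m x).
  have [n Nn [B [C [cB cC BC WBC [rB Cinf]]]]] := sep r N.
  exists n => //; apply: contrapT => no.
  apply: (hr B C _ cB cC BC rB Cinf cV _ clV Vy0) => x y Vx xy.
  by rewrite -WBC => Wy; apply: no; exists x; rewrite /iterate_total xy.
have [n1 _ [x1 [Vx1 W1]]] := meet 0%N.
have [n2 n12 [x2 [Vx2 W2]]] := meet n1.+1.
have it x : V x -> iterate f m x = Some (iterate_total f m x).
  by move=> /VF/(@Fatou_defined _ _ m)/iterate_Some_total.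
(* f ^ m (V) lies in one Fatou component, so Wn n1 and Wn n2 meet *)
have cfV : connected (iterate_total f m @` V).
  apply: connected_continuous_connected => //.
  apply: continuous_in_subspaceT => x; rewrite inE => /it/(iterate_near mf).
  by case.
have : connected_component (Fatou f) (iterate_total f m x1) (iterate_total f m x2).
  exists (iterate_total f m @` V); last by exists x2.
  split=> //.
  by move=> _ [x Vx <-]; exact: (Fatou_iterate mf ncf (VF _ Vx) (it _ Vx)).
have [[x' _ Wx'] _] := orb.2 n1; move: W1; rewrite Wx' => W1.
rewrite -(same_connected_component W1) -Wx' => W12.
have n12' : n1 <> n2 by move=> n12'; move: n12; rewrite n12' ltnn.
have : set0 (iterate_total f m x2) by rewrite -(dis _ _ n12').
by [].
Qed.
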